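(* Assume $1<p_1,p_2<\infty$ and $\max(p_1,p_2)\le q<\infty$. Then $$\mathcal H_2:L^{p_1}(v_1;I)\times L^{p_2}(v_2;I)\to L^q(u;I)$$ is compact if and only if $$\mathcal D(u)<\infty,\qquad \lim_{c\downarrow a}\mathcal D_-(c)=0,\qquad\text{and}\qquad \lim_{d\uparrow b}\mathcal D_+(d)=0 .$$
   Context: Let $-\infty\le a<b\le\infty$, $I=(a,b)$, $1/p_i+1/p_i'=1$. Let $v_1,v_2$ be measurable on $I$, positive and finite a.e., and let $u\ge0$ be measurable with $u\in L^1_{\mathrm{loc}}(I)$. Assume $V_i(x):=\int_a^x v_i(t)^{1-p_i'}\,dt<\infty$ for all $x\in I$, $i=1,2$. $X_i=L^{p_i}(v_i;I)$ has norm $(\int_I|f|^{p_i}v_i\,dx)^{1/p_i}$ and $Y=L^q(u;I)$ has norm $(\int_I|h|^qu\,dx)^{1/q}$ (real or complex functions, identified when equal a.e. for the relevant measure). Define $Hf(x)=\int_a^xf(t)\,dt$ and $\mathcal H_2(f,g)(x)=Hf(x)\,Hg(x)$. $\mathcal H_2:X_1\times X_2\to Y$ is compact if the image of the product of the closed unit balls of $X_1$ and $X_2$ has compact closure in $Y$. For a nonnegative measurable $w$ on $I$, $$\mathcal D(w)=\sup_{a<x<b}\Big(\int_x^bw(t)\,dt\Big)^{1/q}V_1(x)^{1/p_1'}V_2(x)^{1/p_2'}\in[0,\infty].$$ For $c,d\in I$, $$\mathcal D_-(c)=\mathcal D(u\chi_{(a,c)})=\sup_{a<x<c}\Big(\int_x^cu(t)\,dt\Big)^{1/q}V_1(x)^{1/p_1'}V_2(x)^{1/p_2'},$$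 $$\mathcal D_+(d)=\mathcal D(u\chi_{(d,b)})=\sup_{a<x<b}\Big(\int_{\max\{x,d\}}^bu(t)\,dt\Big)^{1/q}V_1(x)^{1/p_1'}V_2(x)^{1/p_2'}.$$ If $a=-\infty$, $c\downarrow a$ means $c\to-\infty$; if $b=\infty$, $d\uparrow b$ means $d\to+\infty$. *)

(* Defs.v *)
From HB Require Import structures.
From mathcomp Require Import all_boot all_order all_algebra complex.
From mathcomp Require Import all_classical all_reals all_analysis measurable_realfun.
Set Implicit Arguments.
Unset Strict Implicit.
Unset Printing Implicit Defensive.
Import Order.TTheory GRing.Theory Num.Theory.
Import numFieldNormedType.Exports.

Local Open Scope classical_set_scope.
Local Open Scope ring_scope.
Local Open Scope quotient_scope.

(* The spaces may be taken over either scalar field. Both cases are carried by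
   R[i]-valued functions, which have to be real-valued over [RealScalars]. *)
Inductive scalars := RealScalars | ComplexScalars.

Definition is_scalar (R : realType) (F : scalars) (z : R[i]) : Prop :=
  match F with
  | RealScalars => complex.Im z = 0
  | ComplexScalars => True
  end.

Definition oint (R : realType) (a b : \bar R) : set R :=
  [set x : R | (a < x%:E < b)%E].

(* Only the values of the weight almost everywhere on I matter. *)
Definition wLnorm (R : realType) (I : set R) (w : R -> \bar R) (p : R)
    (f : R -> R[i]) : \bar R :=
  ((\int[lebesgue_measure]_(x in I) ((Normc.normc (f x) `^ p)%:E * w x))
     `^ p^-1)%E.

(* For w >= 0, this is equality almost everywhere on I for the measure w dx. *)
Definition wae_eq (R : realType) (I : set R) (w : R -> \bar R)
    (f g : R -> R[i]) : Prop :=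
  f = g %[ae lebesgue_measure in I `&` [set x | w x != 0%E]].

Definition is_wLfun (R : realType) (F : scalars) (I : set R) (w : R -> \bar R)
    (p : R) (f : R -> R[i]) : Prop :=
  [/\ measurable_fun I (fun x => complex.Re (f x)),
      measurable_fun I (fun x => complex.Im (f x)),
      forall x, I x -> is_scalar F (f x)
    & (wLnorm I w p f < +oo)%E].

Record wLfun (R : realType) (F : scalars) (I : set R) (w : R -> \bar R)
    (p : R) := WLfun {
  wLfun_fun :> R -> R[i] ;
  wLfunP : is_wLfun F I w p wLfun_fun }.

Section wLspace.
Context (R : realType) (F : scalars) (I : set R) (w : R -> \bar R) (p : R).

HB.instance Definition _ := gen_eqMixin (wLfun F I w p).
HB.instance Definition _ := gen_choiceMixin (wLfun F I w p).

Definition wae_eq_op (f g : wLfun F I w p) : bool := `[< wae_eq I w f g >].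

Lemma wae_eq_op_refl : reflexive wae_eq_op.
Proof. by move=> f; apply/asboolP; exact: ae_eq_refl. Qed.

Lemma wae_eq_op_sym : symmetric wae_eq_op.
Proof.
by move=> f g; apply/idP/idP => /asboolP fg; apply/asboolP; exact: ae_eq_sym.
Qed.

Lemma wae_eq_op_trans : transitive wae_eq_op.
Proof.
by move=> g f h /asboolP fg /asboolP gh; apply/asboolP; exact: ae_eq_trans fg gh.
Qed.

Canonical wae_eq_op_canonical :=
  EquivRel wae_eq_op wae_eq_op_refl wae_eq_op_sym wae_eq_op_trans.

(* The space L^p(w; I) over the scalars F. *)
Definition wLspace : Type := {eq_quot wae_eq_op}.
HB.instance Definition _ := Choice.on wLspace.
HB.instance Definition _ := EqQuotient.on wLspace.

Definition wLspace_to_fun (f : wLspace) : R -> R[i] := repr f.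
Coercion wLspace_to_fun : wLspace >-> Funclass.

Definition wLball (f : wLspace) (e : R) : set wLspace :=
  [set g : wLspace | (wLnorm I w p (fun x => (f x - g x)%R) < e%:E)%E].

Definition wLclosed_unit_ball : set wLspace :=
  [set f : wLspace | (wLnorm I w p f <= 1)%E].

(* The norm topology, given by its open sets: this needs no assumption on the
   weight, whereas the triangle inequality would. *)
Definition wLopen (U : set wLspace) : Prop :=
  forall f, U f -> exists2 e : R, 0 < e & wLball f e `<=` U.

Lemma wLopenT : wLopen setT.
Proof. by move=> f _; exists 1. Qed.

Lemma wLopenI : setI_closed wLopen.
Proof.
move=> U V oU oV f [/oU[d d0 dU] /oV[e e0 eV]].
exists (Num.min d e); first by rewrite lt_min d0 e0.
move=> g fg; split; [apply: dU|apply: eV];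
  by rewrite /wLball/= (lt_le_trans fg)// lee_fin ge_min lexx ?orbT.
Qed.

Lemma wLopen_bigU (J : Type) (U : J -> set wLspace) :
  (forall j, wLopen (U j)) -> wLopen (\bigcup_j U j).
Proof.
by move=> oU f [j _ /oU[e e0 eU]]; exists e => // g /eU Ug; exists j.
Qed.

HB.instance Definition _ :=
  isOpenTopological.Build wLspace wLopenT wLopenI wLopen_bigU.

End wLspace.

Section hardy.
Context (R : realType) (a : \bar R).

Definition hardy (f : R -> R[i]) (x : R) : R[i] :=
  Complex (\int[lebesgue_measure]_(t in oint a x%:E) complex.Re (f t))
          (\int[lebesgue_measure]_(t in oint a x%:E) complex.Im (f t)).

Definition hardy2 (f g : R -> R[i]) (x : R) : R[i] := hardy f x * hardy g x.

End hardy.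

Definition compact_bilinear (R : realType) (F : scalars) (I : set R)
    (v1 v2 u : R -> \bar R) (p1 p2 q : R)
    (T : wLspace F I v1 p1 -> wLspace F I v2 p2 -> wLspace F I u q) : Prop :=
  compact (closure [set h | exists f g,
    [/\ wLclosed_unit_ball f, wLclosed_unit_ball g & h = T f g]]).

(* Compactness includes that [hardy2] takes its values in L^q(u; I), i.e. that
   it induces an operator T (necessarily unique) between the spaces. *)
Definition hardy2_compact (R : realType) (F : scalars) (a b : \bar R)
    (v1 v2 u : R -> \bar R) (p1 p2 q : R) : Prop :=
  let I := oint a b in
  exists T : wLspace F I v1 p1 -> wLspace F I v2 p2 -> wLspace F I u q,
    (forall f g, wae_eq I u (T f g) (hardy2 a f g)) /\ compact_bilinear T.

(* Here p' is the conjugate exponent of p. *)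
Definition wV (R : realType) (a : \bar R) (v : R -> \bar R) (p' : R) (x : R)
    : \bar R :=
  (\int[lebesgue_measure]_(t in oint a x%:E) (v t `^ (1 - p')))%E.

Section D.
Context (R : realType) (a b : \bar R) (v1 v2 : R -> \bar R) (p1' p2' q : R).

Definition D (w : R -> \bar R) : \bar R :=
  ereal_sup [set
    ((\int[lebesgue_measure]_(t in oint x%:E b) w t) `^ q^-1
      * wV a v1 p1' x `^ p1'^-1 * wV a v2 p2' x `^ p2'^-1)%E | x in oint a b].

Definition Dminus (u : R -> \bar R) (c : R) : \bar R :=
  D (fun t => u t * (\1_(oint a c%:E) t)%:E)%E.

Definition Dplus (u : R -> \bar R) (d : R) : \bar R :=
  D (fun t => u t * (\1_(oint d%:E b) t)%:E)%E.

End D.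

(* The filters "c decreases to a" and "d increases to b" for a < b; the values
   at a = +oo and b = -oo are irrelevant. *)
Definition decr_to (R : realType) (a : \bar R) : set_system R :=
  if a is r%:E%E then r^'+ else ninfty_nbhs R.

Definition incr_to (R : realType) (b : \bar R) : set_system R :=
  if b is r%:E%E then r^'- else pinfty_nbhs R.

(* Main.v *)
(* Necessity. The function v_i^(1 - p_i') 1_(a, x), normalized in X_i, has a Hardy
   transform equal to V_i(x)^(1 / p_i') on (x, b). Hence D(w) is at most the
   supremum over the image of the unit balls of the norms in L^q(w), for w = u,
   u 1_(a, c) and u 1_(d, b). On a compact subset of L^q(u) the norms are bounded,
   and the norms of the restrictions to (a, c) and to (d, b) tend to 0 uniformly.

   Sufficiency. If F is the primitive of f >= 0, cutting at the points where F is
   a power of 2 and applying Hoelder's inequality on each piece gives the weighted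
   Hardy inequality for p <= q, the sum over the pieces being controlled since
   q / p >= 1. Applied to g with the weight (Hf)^q w, it reduces the bilinear
   inequality to two linear ones, and the norm of H_2 into L^q(w) is at most a
   constant times D(w). The functions Hf, for f in the unit ball, are moreover
   pointwise bounded and equicontinuous, so that along any ultrafilter H_2(f, g)
   converges uniformly on compact subintervals, hence in L^q(u) there; the tails
   are small by the conditions on D_- and D_+. No completeness of L^q(u) and no
   weak compactness of the unit balls is needed, because the pointwise limit is
   continuous and belongs to L^q(u) by the bounds on compact subintervals. *)
Require Import Defs.
From mathcomp Require Import all_boot all_order all_algebra complex.
From mathcomp Require Import all_classical all_reals all_analysis measurable_realfun.
From mathcomp Require Import ring lra.
Import Order.TTheory GRing.Theory Num.Theory.
Import numFieldNormedType.Exports.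
Local Open Scope classical_set_scope.
Local Open Scope ring_scope.

Set Implicit Arguments.
Unset Strict Implicit.
Unset Printing Implicit Defensive.

Local Notation normc := Normc.normc.

(** * Open intervals and exhaustion by compact subintervals *)

(** The gain in the linear inequality comes from one point per level. F is continuous and tends to 0
    at [a], so a positive level l exceeded by F is attained at some x_l; the set F > l lies in (x_l,
    b), and f has mass l/3 between the levels 2l/3 and l. Hoelder on that piece bounds (l/3)^q by a
    power of its energy times V(x_l)^(q/p'), which is exactly the factor that the condition at x_l
    pairs with the weight. The weight itself is never differentiated or dualized, so (Hf)^q w is as
    admissible as w, and the inequality can be iterated. In the compactness argument the obstacle is
    that elements of L^q(u) are classes, while convergence is observed pointwise. Each z in the
    image is given a pair (f, g) by choice, and the ultrafilter on classes is read on the family of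
    functions H_2(f, g) indexed by z. Points of the closure have no such pair, hence a preliminary
    reduction to ultrafilters that contain the image itself. Constants are not sharp: norms enter
    through their q-th powers with a factor 2^q in the triangle inequality, and real and imaginary
    parts are estimated separately. *)

Section open_intervals.
Context {R : realType}.
Implicit Types (a b : \bar R) (x c d : R).
Local Notation mu := (@lebesgue_measure R).

Lemma open_oint a b : open (oint a b).
Proof.
rewrite (_ : oint a b = [set r | (a < r%:E)%E] `&` [set r | (r%:E < b)%E]).
  by apply: openI; [exact: open_ereal_gt|exact: open_ereal_lt].
apply/seteqP; split => x; rewrite /oint/=; first by move=> /andP.
by case=> -> ->.
Qed.

Lemma measurable_oint a b : measurable (oint a b : set R).
Proof. by apply: open_measurable; exact: open_oint. Qed.

Lemma oint_itv c d : oint c%:E d%:E = `]c, d[%classic.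
Proof. by apply/seteqP; split => x; rewrite /oint/= in_itv/= !lte_fin. Qed.

Lemma sub_ointl a b c : oint a b c -> oint a c%:E `<=` oint a b.
Proof.
by move=> /andP[ac cb] x /andP[ax xc]; apply/andP; split=> //; exact: lt_trans cb.
Qed.

Lemma sub_ointr a b c : oint a b c -> oint c%:E b `<=` oint a b.
Proof.
by move=> /andP[ac cb] x /andP[ax xc]; apply/andP; split=> //; exact: lt_trans ax.
Qed.

Lemma sub_itv_oint a b c d : (a < c%:E)%E -> (d%:E < b)%E ->
  `[c, d]%classic `<=` oint a b.
Proof.
move=> ac db x /=; rewrite in_itv/= => /andP[cx xd]; apply/andP; split.
  by rewrite (lt_le_trans ac)// lee_fin.
by rewrite (le_lt_trans _ db)// lee_fin.
Qed.

Lemma oint_seq a b : (a < b)%E -> exists c d : nat -> R,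
  [/\ nonincreasing_seq c, nondecreasing_seq d,
      forall n, (a < (c n)%:E)%E, forall n, ((d n)%:E < b)%E
    & forall x, oint a b x -> exists n, c n <= x <= d n].
Proof.
move=> ab.
have Hinv : forall x : R, 0 < x -> \forall n \near \oo, n.+1%:R^-1 < x.
  by move=> x x0; near=> n; near: n; exact: near_infty_natSinv_lt (PosNum x0).
have Hbig : forall x : R, \forall n \near \oo, x < n%:R.
  exact: nbhs_infty_gtr.
(* The two sequences may cross for small n; the segment from [c n] to [d n] is then empty, which is
   harmless. *)
pose c n : R := if a is r%:E%E then r + n.+1%:R^-1 else - n%:R.
pose d n : R := if b is r%:E%E then r - n.+1%:R^-1 else n%:R.
have le_inv (m n : nat) : (m <= n)%N -> n.+1%:R^-1 <= m.+1%:R^-1 :> R.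
  by move=> mn; rewrite lef_pV2 ?posrE ?ltr0n// ler_nat.
exists c, d; split.
- apply/nonincreasing_seqP => n; rewrite /c; case: (a) ab => [r| |] // _.
    by rewrite lerD2l le_inv.
  by rewrite lerN2 ler_nat.
  by rewrite lerN2 ler_nat.
- apply/nondecreasing_seqP => n; rewrite /d; case: (b) ab => [r| |] // _.
    by rewrite lerD2l lerN2 le_inv.
  by rewrite ler_nat.
  by rewrite ler_nat.
- move=> n; rewrite /c; case: (a) ab => [r| |] //.
    by rewrite lte_fin ltrDl invr_gt0.
  - by rewrite ltNge leey.
  - by move=> _; exact: ltNyr.
- move=> n; rewrite /d; case: (b) ab => [r| |] //.
    by rewrite lte_fin gtrDl oppr_lt0 invr_gt0.
  - by move=> _; exact: ltry.
  - by rewrite ltNge leNye.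
- move=> x /andP[ax xb].
  suff : \forall n \near \oo, c n <= x /\ x <= d n.
    by move=> /filter_ex[n [cx xd]]; exists n; apply/andP.
  apply: filterI.
    rewrite /c; case: (a) ab ax => [r| |] // _.
      rewrite lte_fin -subr_gt0 => /Hinv; apply: filterS => n nx.
      by rewrite -lerBrDl ltW.
    by move=> _; apply: filterS (Hbig (- x)) => n /ltW; rewrite lerNl.
  rewrite /d; case: (b) ab xb => [r| |] // _.
    rewrite lte_fin -subr_gt0 => /Hinv; apply: filterS => n nx.
    by rewrite lerBrDr -lerBrDl ltW.
  by move=> _; apply: filterS (Hbig x) => n /ltW.
Unshelve. all: by end_near. Qed.

Lemma oint_neq0 a b : (a < b)%E -> oint a b !=set0.
Proof.
case: a b => [r| |] [s| |]//.
- rewrite lte_fin => rs; exists ((r + s) / 2).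
  by rewrite /oint/= !lte_fin midf_lt//= midf_lt.
- by move=> _; exists (r + 1); rewrite /oint/= ltry lte_fin ltrDl ltr01.
- by move=> _; exists (s - 1); rewrite /oint/= ltNyr lte_fin gtrDl oppr_lt0 ltr01.
- by move=> _; exists 0; rewrite /oint/= ltNyr ltry.
Qed.

Global Instance decr_to_filter a : ProperFilter (decr_to a).
Proof. by case: a => [r| |]/=; exact: _. Qed.

Global Instance incr_to_filter b : ProperFilter (incr_to b).
Proof. by case: b => [r| |]/=; exact: _. Qed.

Lemma near_decr_to a x : (a < x%:E)%E ->
  \forall c \near decr_to a, (a < c%:E)%E /\ c < x.
Proof.
case: a => [r| |] //=.
- rewrite lte_fin => rx; near=> c; split; rewrite ?lte_fin.
    by near: c; exact: nbhs_right_gt.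
  by near: c; exact: nbhs_right_lt.
- by move=> _; exists x; split; rewrite ?num_real// => y yx; rewrite ltNyr.
Unshelve. all: by end_near. Qed.

Lemma near_incr_to b x : (x%:E < b)%E ->
  \forall c \near incr_to b, (c%:E < b)%E /\ x < c.
Proof.
case: b => [r| |] //=.
- rewrite lte_fin => rx; near=> c; split; rewrite ?lte_fin.
    by near: c; exact: nbhs_left_lt.
  by near: c; exact: nbhs_left_gt.
- by move=> _; exists x; split; rewrite ?num_real// => y yx; rewrite ltry.
Unshelve. all: by end_near. Qed.

Section exhaustion.
Variables (a b : \bar R) (g : R -> \bar R).
Hypotheses (ab : (a < b)%E) (mg : measurable_fun (oint a b) g)
  (g0 : forall x, oint a b x -> (0 <= g x)%E).

Let exhaustion : exists c d : nat -> R,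
  [/\ forall n, (a < (c n)%:E)%E, forall n, ((d n)%:E < b)%E
    & (\int[mu]_(x in `[c n, d n]) g x)%E @[n --> \oo] -->
      (\int[mu]_(x in oint a b) g x)%E].
Proof.
have [c [d [nic ndd ac db cd]]] := oint_seq ab.
exists c, d; split=> //.
have -> : oint a b = \bigcup_n `[c n, d n]%classic.
  apply/seteqP; split => [x /cd[n cxd]|x [n _]]; last exact: sub_itv_oint.
  by exists n => //=; rewrite in_itv.
apply: (@ge0_nondecreasing_set_cvg_integral _ _ R
  (fun n => `[c n, d n]%classic : set (measurableTypeR R)) g mu).
- apply/nondecreasing_seqP => n; rewrite subsetEset.
  by apply: subset_itv; rewrite bnd_simp; [exact: nic|exact: ndd].
- by move=> n; exact: measurable_itv.
- move=> n; apply: measurable_funS mg; first exact: measurable_oint.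
  exact: sub_itv_oint.
- by move=> n x cxd; apply: g0; exact: (sub_itv_oint (ac n) (db n)).
Qed.

(** Plays the part of Fatou's lemma: a limit that is controlled only on segments is shown to be
    integrable on the whole interval. *)
Lemma ge0_integral_oint_le (M : \bar R) :
  (forall c d, (a < c%:E)%E -> (d%:E < b)%E ->
     (\int[mu]_(x in `[c, d]) g x <= M)%E) ->
  (\int[mu]_(x in oint a b) g x <= M)%E.
Proof.
move=> gM; have [c [d [ac db cvg]]] := exhaustion.
rewrite -(cvg_lim _ cvg)//; apply: lime_le; first by apply/cvg_ex; eexists; exact: cvg.
by near=> n; exact: gM.
Unshelve. all: by end_near. Qed.

(** Monotone convergence along an exhaustion; finiteness of the total integral allows the
    subtraction. Both the continuity of primitives and the smallness of the tails of a single
    function come from here. *)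
Lemma ge0_integral_oint_tail (e : R) : 0 < e ->
  (\int[mu]_(x in oint a b) g x < +oo)%E -> exists c d,
  [/\ (a < c%:E)%E, (d%:E < b)%E
    & (\int[mu]_(x in oint a b `\` `[c, d]) g x <= e%:E)%E].
Proof.
move=> e0 gfin; have [c [d [ac db cvg]]] := exhaustion.
set J := (\int[mu]_(x in oint a b) g x)%E in gfin cvg *.
have J0 : (0 <= J)%E by exact: integral_ge0.
have Jfin : J \is a fin_num by rewrite ge0_fin_numE.
have near_ : \forall n \near \oo, (J - e%:E < \int[mu]_(x in `[c n, d n]) g x)%E.
  apply: (cvg [set y | (J - e%:E < y)%E]); apply: open_ereal_gt'.
  by rewrite lteBlDr// lteDl ?lte_fin.
have [n nJ] := filter_ex near_.
have Icd := sub_itv_oint (ac n) (db n).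
exists (c n), (d n); split => //.
have : J = (\int[mu]_(x in `[c n, d n]) g x +
            \int[mu]_(x in oint a b `\` `[c n, d n]) g x)%E.
  rewrite /J -{1}(setDUK Icd) ge0_integral_setU//.
  - by apply: measurableD => //; exact: measurable_oint.
  - by rewrite setDUK.
  - by rewrite setDUK.
  - by rewrite disj_set2E setDIK.
have I1 : (\int[mu]_(x in `[c n, d n]) g x)%E \is a fin_num.
  rewrite ge0_fin_numE; last by apply: integral_ge0 => x /Icd; exact: g0.
  apply: le_lt_trans gfin; apply: ge0_subset_integral => //.
  exact: measurable_oint.
move=> JE; rewrite -(@leeD2lE _ _ _ _ I1) -JE.
by move: nJ; rewrite lteBlDr// => /ltW; rewrite addeC.
Qed.

Lemma ge0_integral_oint_near_left (e : R) : 0 < e ->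
  (\int[mu]_(x in oint a b) g x < +oo)%E ->
  \forall c \near decr_to a, (\int[mu]_(x in oint a b `&` oint a c%:E) g x <= e%:E)%E.
Proof.
move=> e0 /(ge0_integral_oint_tail e0)[c [d [ac db le]]].
near=> x; apply: le_trans le; apply: ge0_subset_integral => //.
- by apply: measurableI; exact: measurable_oint.
- by apply: measurableD => //; exact: measurable_oint.
- by apply: measurable_funS mg => //; exact: measurable_oint.
- by move=> y [/g0].
- move=> y [Iy /andP[ay yx]]; split => //=; rewrite in_itv/= => /andP[cy _].
  have : (a < x%:E)%E /\ x < c by near: x; exact: near_decr_to.
  by case=> _ xc; move: yx; rewrite lte_fin => /lt_trans -/(_ _ xc); rewrite ltNge cy.
Unshelve. all: by end_near. Qed.

Lemma ge0_integral_oint_near_right (e : R) : 0 < e ->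
  (\int[mu]_(x in oint a b) g x < +oo)%E ->
  \forall d \near incr_to b, (\int[mu]_(x in oint a b `&` oint d%:E b) g x <= e%:E)%E.
Proof.
move=> e0 /(ge0_integral_oint_tail e0)[c [d [ac db le]]].
near=> x; apply: le_trans le; apply: ge0_subset_integral => //.
- by apply: measurableI; exact: measurable_oint.
- by apply: measurableD => //; exact: measurable_oint.
- by apply: measurable_funS mg => //; exact: measurable_oint.
- by move=> y [/g0].
- move=> y [Iy /andP[xy yb]]; split => //=; rewrite in_itv/= => /andP[_ yd].
  have : (x%:E < b)%E /\ d < x by near: x; exact: near_incr_to.
  by case=> _ dx; move: xy; rewrite lte_fin => /(lt_trans dx); rewrite ltNge yd.
Unshelve. all: by end_near. Qed.

End exhaustion.
End open_intervals.

(** * Weighted Hoelder inequality *)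

Section weighted_hoelder.
Context {R : realType}.
Local Notation mu := (@lebesgue_measure R).

Lemma ae_imply (P Q : R -> Prop) : (forall x, P x -> Q x) ->
  {ae mu, forall x, P x} -> {ae mu, forall x, Q x}.
Proof. by move=> PQ; exact: (@filterS _ _ (ae_filter_ringOfSetsType mu)). Qed.

(** The second identity computes the conjugate factor of Hoelder, (v^(-1/p))^p' = v^(1 - p'). The
    third one computes the norm of the extremal function, (v^(1 - p'))^p v = v^(1 - p'). *)
Lemma conj_exponent (p p' : R) : 1 < p -> p^-1 + p'^-1 = 1 ->
  [/\ 0 < p', p^-1 * p' = p' - 1 & (1 - p') * p + 1 = 1 - p'].
Proof.
move=> p1 pp'.
have p0 : 0 < p by rewrite (lt_trans ltr01).
have p'V : p'^-1 = 1 - p^-1 by rewrite -pp' addrC addKr.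
have p'0 : 0 < p' by rewrite -invr_gt0 p'V subr_gt0 invf_lt1.
have pV : p^-1 = 1 - p'^-1 by rewrite p'V opprB addrC subrK.
have E : p^-1 * p' = p' - 1 by rewrite pV mulrBl mul1r mulVf// gt_eqF.
split=> //.
have : p * (p' - 1) = p' by rewrite -E mulrA mulfV ?mul1r// gt_eqF.
by move=> /(congr1 -%R) /(congr1 (+%R 1)); lra.
Qed.

(* [`|v x|] and not [v x]: a weight may take negative values on a null set. *)
Lemma weighted_hoelder (A : set R) (f : R -> R) (v : R -> \bar R) (p p' : R) :
  1 < p -> p^-1 + p'^-1 = 1 -> measurable A ->
  measurable_fun A f -> (forall x, A x -> 0 <= f x) -> measurable_fun A v ->
  {ae mu, forall x, A x -> (0 < v x < +oo)%E} ->
  (\int[mu]_(x in A) (f x)%:E <=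
   (\int[mu]_(x in A) ((f x `^ p)%:E * `|v x|)) `^ p^-1 *
   (\int[mu]_(x in A) (v x `^ (1 - p'))) `^ p'^-1)%E.
Proof.
move=> p1 pp' mA mf f0 mv vpos.
have [p'0 E1 _] := conj_exponent p1 pp'.
have p0 : 0 < p by rewrite (lt_trans ltr01).
pose w x := `|fine (v x)|.
have mw : measurable_fun A w by do 2 apply: measurableT_comp => //.
(* The product f = (f w^(1/p)) w^(-1/p), each factor extended by 0 outside A, since [hoelder] is
   applied on the whole line. *)
pose F := (fun x => f x * w x `^ p^-1) \_ A.
pose G := (fun x => w x `^ (- p^-1)) \_ A.
have mwr r : measurable_fun A (fun x => w x `^ r).
  by apply: (measurableT_comp (measurable_powR r)).
have mF' : measurable_fun A (fun x => f x * w x `^ p^-1) by exact: measurable_funM.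
have mF : measurable_fun setT F by apply/(measurable_restrictT _ mA).
have mG : measurable_fun setT G by apply/(measurable_restrictT _ mA).
have mfp r : measurable_fun A (fun x => f x `^ r).
  by apply: (measurableT_comp (measurable_powR r)).
have := hoelder mu mF mG p0 p'0 pp'.
rewrite Lnorm1 unlock.
have -> : (\int[mu]_x `|(EFin \o (F \* G)%R) x|)%E = (\int[mu]_(x in A) (f x)%:E)%E.
  transitivity (\int[mu]_(x in A) (f x * w x `^ p^-1 * w x `^ (- p^-1))%:E)%E.
    rewrite [RHS]integral_mkcond; apply: eq_integral => x _ /=.
    rewrite /F /G !patchE; case: ifPn; rewrite ?mulr0 ?normr0// inE => Ax.
    by rewrite ger0_norm// !mulr_ge0 ?powR_ge0 ?f0.
  apply: ge0_ae_eq_integral => //.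
  - by apply/measurable_EFinP; apply: measurable_funM => //; exact: mwr.
  - exact/measurable_EFinP.
  - by move=> x Ax; rewrite lee_fin !mulr_ge0 ?powR_ge0 ?f0.
  - move: vpos; apply: ae_imply => x /[swap] Ax /(_ Ax); rewrite /w.
    case: (v x) => [r| |]//=; case/andP=> + _ //; rewrite lte_fin => r0; rewrite gtr0_norm//.
    by rewrite powRN mulfK ?gt_eqF ?powR_gt0//.
have -> : (\int[mu]_x `|(EFin \o F) x| `^ p)%E =
   (\int[mu]_(x in A) ((f x `^ p)%:E * `|v x|))%E.
  transitivity (\int[mu]_(x in A) (f x `^ p * w x)%:E)%E.
    transitivity (\int[mu]_(x in A) ((f x * w x `^ p^-1) `^ p)%:E)%E.
      rewrite [RHS]integral_mkcond; apply: eq_integral => x _ /=.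
      rewrite /F !patchE; case: ifPn; rewrite ?normr0 ?powR0 ?gt_eqF// inE => Ax.
      by rewrite ger0_norm// !mulr_ge0 ?powR_ge0 ?f0.
    apply: ge0_ae_eq_integral => //.
    - apply/measurable_EFinP.
      exact: (measurableT_comp (measurable_powR p)).
    - by apply/measurable_EFinP; apply: measurable_funM => //; exact: mfp.
    - by move=> x Ax; rewrite lee_fin powR_ge0.
    - by move=> x Ax; rewrite lee_fin mulr_ge0 ?powR_ge0 /w ?normr_ge0.
    - move: vpos; apply: ae_imply => x /[swap] Ax /(_ Ax); rewrite /w.
      case: (v x) => [r| |]//=; case/andP=> + _ //; rewrite lte_fin => r0; rewrite gtr0_norm//.
      by rewrite powRM ?powR_ge0 ?f0// -powRrM mulVf ?gt_eqF// powRr1// ltW.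
  apply: ge0_ae_eq_integral => //.
  - by apply/measurable_EFinP; apply: measurable_funM => //; exact: mfp.
  - apply: emeasurable_funM; first by apply/measurable_EFinP; exact: mfp.
    exact: measurableT_comp.
  - by move=> x Ax; rewrite lee_fin mulr_ge0 ?powR_ge0 /w ?normr_ge0.
  - by move=> x Ax; rewrite mule_ge0 ?lee_fin ?powR_ge0.
  - move: vpos; apply: ae_imply => x /[swap] Ax /(_ Ax); rewrite /w.
    by case: (v x) => [r| |] //= /andP[].
have -> : (\int[mu]_x `|(EFin \o G) x| `^ p')%E =
   (\int[mu]_(x in A) (v x `^ (1 - p')))%E.
  transitivity (\int[mu]_(x in A) ((w x `^ (- p^-1)) `^ p')%:E)%E.
    rewrite [RHS]integral_mkcond; apply: eq_integral => x _ /=.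
    rewrite /G !patchE; case: ifPn; rewrite ?normr0 ?powR0 ?gt_eqF// inE => Ax.
    by rewrite ger0_norm// ?powR_ge0.
  apply: ge0_ae_eq_integral => //.
  - apply/measurable_EFinP; apply: (measurableT_comp (measurable_powR p')).
    exact: mwr.
  - by apply: (measurableT_comp (measurable_poweR (1 - p'))).
  - by move=> x Ax; rewrite lee_fin powR_ge0.
  - by move=> x Ax; rewrite poweR_ge0.
  - move: vpos; apply: ae_imply => x /[swap] Ax /(_ Ax); rewrite /w.
    case: (v x) => [r| |]//=; case/andP=> + _ //; rewrite lte_fin => r0.
    by rewrite gtr0_norm// -powRrM mulNr E1 opprB.
by [].
Qed.
End weighted_hoelder.

(** * Primitives *)

Section primitive.
Context {R : realType}.
Local Notation mu := (@lebesgue_measure R).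
Variables (a b : \bar R) (s : R -> \bar R).
Hypotheses (ms : measurable_fun (oint a b) s)
  (s0 : forall x, oint a b x -> (0 <= s x)%E).

Lemma integral_oint_split x y : oint a b x -> oint a b y -> x < y ->
  (\int[mu]_(t in oint a y%:E) s t =
   \int[mu]_(t in oint a x%:E) s t + \int[mu]_(t in oint x%:E y%:E) s t)%E.
Proof.
move=> Ix Iy xy; have := Ix; rewrite /oint/= => /andP[ax xb].
(* The intervals are open, so x belongs to neither half; it is removed from (a, y) as a null set. *)
have E : oint a y%:E `\ x = oint a x%:E `|` oint x%:E y%:E.
  apply/seteqP; split => t; rewrite /oint/= !lte_fin.
    by move=> [/andP[-> ->] /eqP]; rewrite neq_lt/= => /orP[] ->; [left|right].
  move=> [/andP[at_ tx]|/andP[xt ty]].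
    by rewrite at_ (lt_trans tx)//; split=> //; apply/eqP; rewrite lt_eqF.
  rewrite ty (lt_trans ax) ?lte_fin//; split=> //; apply/eqP.
  by rewrite gt_eqF.
have sub : oint a y%:E `\ x `<=` oint a b by move=> t [/(sub_ointl Iy)].
rewrite -(@integral_setD1 _ _ x); last 2 first.
- by apply: measurableD; [exact: measurable_oint|exact: measurable_set1].
- by apply: measurable_funS ms; [exact: measurable_oint|].
rewrite E ge0_integral_setU//.
- exact: measurable_oint.
- exact: measurable_oint.
- by rewrite -E; apply: measurable_funS ms; [exact: measurable_oint|].
- by rewrite -E => t /sub/s0.
- apply/disj_setPS => t [/andP[_ tx] /andP[xt _]].
  by move: (lt_trans tx xt); rewrite ltxx.
Qed.

Hypothesis sfin : forall x, oint a b x -> (\int[mu]_(t in oint a x%:E) s t < +oo)%E.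

(** The tail estimate is applied at the left end of (x, d) and at the right end of (a, x). It is
    used twice: with s = f for the continuity of a primitive, and with s = v^(1 - p') for the
    equicontinuity of Hardy transforms. *)
Lemma integral_oint_small x (e : R) : oint a b x -> 0 < e ->
  \forall y \near x, oint a b y /\
    (\int[mu]_(t in oint (Num.min x y)%:E (Num.max x y)%:E) s t <= e%:E)%E.
Proof.
move=> Ix e0; have /andP[ax xb] := Ix.
(* [sfin] gives finiteness only up to a point of I, so the right side of x is cut at an interior
   point d. *)
have /(@filter_ex _ _ _)[d [db xd]] := near_incr_to xb.
have Id : oint a b d by rewrite /oint/= db (lt_trans ax)// lte_fin.
have Ixd : oint x%:E d%:E `<=` oint a b.
  by move=> t /andP[xt td]; rewrite /oint/= (lt_trans ax)// (lt_trans td).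
have Iax : oint a x%:E `<=` oint a b by exact: sub_ointl.
have R1 : \forall y \near x, x < y ->
    (\int[mu]_(t in oint x%:E d%:E `&` oint x%:E y%:E) s t <= e%:E)%E.
  apply: (@ge0_integral_oint_near_left _ x%:E d%:E s) => //.
  - by apply: measurable_funS ms; [exact: measurable_oint|].
  - by move=> t /Ixd/s0.
  - apply: le_lt_trans (sfin Id); apply: ge0_subset_integral.
    + exact: measurable_oint.
    + exact: measurable_oint.
    + by apply: measurable_funS ms; [exact: measurable_oint|exact: sub_ointl].
    + by move=> t /(sub_ointl Id)/s0.
    + by move=> t /andP[xt td]; rewrite /oint/= td (lt_trans ax).
have L1 : \forall y \near x, y < x ->
    (\int[mu]_(t in oint a x%:E `&` oint y%:E x%:E) s t <= e%:E)%E.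
  apply: (@ge0_integral_oint_near_right _ a x%:E s) => //.
  - by apply: measurable_funS ms; [exact: measurable_oint|].
  - by move=> t /Iax/s0.
  - exact: sfin.
near=> y.
have Iy : oint a b y by near: y; apply: open_nbhs_nbhs; split => //; exact: open_oint.
split=> //; have [xy|yx|->] := ltgtP x y; last first.
- rewrite oint_itv set_itvE integral_set0 lee_fin; exact: ltW.
- rewrite (_ : oint y%:E x%:E = oint a x%:E `&` oint y%:E x%:E).
    by move: yx; near: y.
  rewrite setIidr// => t /andP[yt tx]; rewrite /oint/= tx (lt_trans _ yt)//.
  by case/andP : Iy.
- rewrite (_ : oint x%:E y%:E = oint x%:E d%:E `&` oint x%:E y%:E).
    by move: xy; near: y.
  rewrite setIidr// => t /andP[xt ty]; rewrite /oint/= xt (lt_trans ty)//.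
  have : y < d by near: y; exact: lt_nbhsl.
  by rewrite lte_fin.
Unshelve. all: by end_near. Qed.

End primitive.

Section primitive_real.
Context {R : realType}.
Local Notation mu := (@lebesgue_measure R).
Variables (a b : \bar R) (f : R -> R).
Hypotheses (ab : (a < b)%E) (mf : measurable_fun (oint a b) f)
  (f0 : forall x, oint a b x -> 0 <= f x)
  (ffin : forall x, oint a b x -> (\int[mu]_(t in oint a x%:E) (f t)%:E < +oo)%E).

Definition prim (x : R) : R := \int[mu]_(t in oint a x%:E) f t.

Let mfE : measurable_fun (oint a b) (EFin \o f).
Proof. exact/measurable_EFinP. Qed.
Let f0E x : oint a b x -> (0 <= (EFin \o f) x)%E.
Proof. by move=> Ix; rewrite lee_fin f0. Qed.

Lemma primE x : oint a b x -> (prim x)%:E = (\int[mu]_(t in oint a x%:E) (f t)%:E)%E.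
Proof.
move=> Ix; rewrite /prim /Rintegral fineK// ge0_fin_numE ?ffin//.
by apply: integral_ge0 => t /(sub_ointl Ix); exact: f0E.
Qed.

Lemma prim_ge0 x : oint a b x -> 0 <= prim x.
Proof. by move=> Ix; apply: Rintegral_ge0 => t /(sub_ointl Ix); exact: f0. Qed.

Lemma prim_split x y : oint a b x -> oint a b y -> x < y ->
  ((prim y)%:E = (prim x)%:E + \int[mu]_(t in oint x%:E y%:E) (f t)%:E)%E.
Proof. by move=> Ix Iy xy; rewrite !primE//; exact: (integral_oint_split mfE f0E). Qed.

Lemma prim_le x y : oint a b x -> oint a b y -> x <= y -> prim x <= prim y.
Proof.
move=> Ix Iy; rewrite le_eqVlt => /predU1P[->//|xy].
rewrite -lee_fin (prim_split Ix Iy xy) leeDl// integral_ge0// => t xty.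
rewrite f0E//; case/andP : xty => xt ty; case/andP : Ix => ax _; case/andP : Iy => _ yb.
by rewrite /oint/= (lt_trans ax)// (lt_trans ty).
Qed.

Lemma prim_continuous : {in oint a b, continuous prim}.
Proof.
move=> x; rewrite inE => Ix; apply/cvgrPdist_le => e e0; near=> y.
have [Iy] : oint a b y /\
    (\int[mu]_(t in oint (Num.min x y)%:E (Num.max x y)%:E) (f t)%:E <= e%:E)%E.
  by near: y; exact: (integral_oint_small mfE f0E ffin).
have [xy|yx|->] := ltgtP x y; last by move=> _; rewrite subrr normr0 ltW.
- have E := prim_split Ix Iy xy; have le := prim_le Ix Iy (ltW xy).
  rewrite distrC ger0_norm ?subr_ge0//.
  by rewrite -lee_fin EFinB E addeAC subee// add0e.
- have E := prim_split Iy Ix yx; have le := prim_le Iy Ix (ltW yx).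
  rewrite ger0_norm ?subr_ge0//.
  by rewrite -lee_fin EFinB E addeAC subee// add0e.
Unshelve. all: by end_near. Qed.

Lemma measurable_prim : measurable_fun (oint a b) prim.
Proof.
by apply: open_continuous_measurable_fun; [exact: open_oint|exact: prim_continuous].
Qed.

Lemma prim_small (l : R) x : oint a b x -> 0 < l ->
  exists2 c, oint a b c /\ c <= x & prim c <= l.
Proof.
move=> Ix l0; have /andP[ax xb] := Ix.
have H : \forall c \near decr_to a,
   (\int[mu]_(t in oint a x%:E `&` oint a c%:E) (f t)%:E <= l%:E)%E.
  apply: (@ge0_integral_oint_near_left _ a x%:E (EFin \o f)) => //.
  - by apply: measurable_funS mfE; [exact: measurable_oint|exact: sub_ointl].
  - by move=> t /(sub_ointl Ix)/f0E.
  - exact: ffin.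
have [c [[ac cx]]] := filter_ex (filterI (near_decr_to ax) H).
have Ic : oint a b c by rewrite /oint/= ac (lt_trans _ xb).
rewrite setIidr => [le|t /andP[at_ tc]]; last by rewrite /oint/= at_ (lt_trans tc).
by exists c; [split => //; exact: ltW|rewrite -lee_fin primE].
Qed.

(** The primitive tends to 0 at [a], so some c to the left of x lies at or below the level, and the
    intermediate value theorem applies on the segment from c to x. *)
Lemma prim_IVT (l : R) x : oint a b x -> 0 < l -> l < prim x ->
  exists2 y, oint a b y & prim y = l.
Proof.
move=> Ix l0 lx; have [c [Ic cx] cl] := prim_small Ix l0.
have sub : `[c, x]%classic `<=` oint a b.
  by apply: sub_itv_oint; [case/andP : Ic|case/andP: Ix].
have cont : {within `[c, x], continuous prim}.
  apply: (@continuous_in_subspaceT _ _ `[c, x]%classic) => t.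
  by rewrite inE => /sub It; apply: prim_continuous; rewrite inE.
have [|y ycx Py] := @IVT R prim c x l cx cont.
  by rewrite ge_min cl le_max (ltW lx) orbT.
by exists y => //; apply: sub.
Qed.

End primitive_real.

(** * Hardy inequalities *)

Section linear_hardy.
Context {R : realType}.
Local Notation mu := (@lebesgue_measure R).
Variables (a b : \bar R) (f : R -> R) (g : R -> \bar R) (V : R -> R) (p p' q M : R).

(* What the proof retains of Hoelder's inequality: [g] stands for |f|^p v, and
   [V] for the integral of v^(1 - p') from a. *)
Definition hoelder_bound :=
  [/\ [/\ measurable_fun (oint a b) f,
      forall x, oint a b x -> 0 <= f x,
      measurable_fun (oint a b) g,
      forall x, oint a b x -> (0 <= g x)%E
    & (\int[mu]_(x in oint a b) g x <= M%:E)%E],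
    forall x, oint a b x -> 0 <= V x
  & forall x, oint a b x -> forall A, measurable A -> A `<=` oint a x%:E ->
     (\int[mu]_(t in A) (f t)%:E <=
      (\int[mu]_(t in A) g t) `^ p^-1 * (V x `^ p'^-1)%:E)%E].

Hypotheses (fgV : hoelder_bound) (ab : (a < b)%E).

Let I := oint a b.
Let mI : measurable I. Proof. exact: measurable_oint. Qed.

Lemma hoelder_bound_M : 0 <= M.
Proof.
case: fgV => -[mf f0 mg g0 gM] _ _; rewrite -lee_fin (le_trans _ gM)//.
exact: integral_ge0.
Qed.

Lemma hoelder_bound_fin x : I x -> (\int[mu]_(t in oint a x%:E) (f t)%:E < +oo)%E.
Proof.
case: fgV => -[mf f0 mg g0 gM] V0 fg Ix.
have sub := sub_ointl Ix.
apply: le_lt_trans (fg _ Ix _ (measurable_oint _ _) (@subset_refl _ _)) _.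
rewrite lte_mul_pinfty ?poweR_ge0 ?fin_num_poweR ?ltry//.
rewrite ge0_fin_numE; last by apply: integral_ge0 => t /sub/g0.
apply: le_lt_trans (ltry M); apply: le_trans gM; apply: ge0_subset_integral => //.
exact: measurable_oint.
Qed.

Let F := prim a f.

Let mF : measurable_fun I F.
Proof.
case: fgV => -[mf f0 _ _ _] _ _; apply: measurable_prim => //.
exact: hoelder_bound_fin.
Qed.
Let F0 x : I x -> 0 <= F x.
Proof. by case: fgV => -[mf f0 _ _ _] _ _; exact: prim_ge0. Qed.

Let S (s t : R) := I `&` [set x | s < F x <= t].

Let mS s t : measurable (S s t).
Proof.
rewrite (_ : S s t = I `&` F @^-1` `]s, t]%classic); last first.
  by apply/seteqP; split => x; rewrite /S/= in_itv.
exact: mF.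
Qed.

Variables (w : R -> \bar R) (B : R).
Hypotheses (p0 : 0 < p) (pq : p <= q).
Hypotheses (mw : measurable_fun I w) (w0 : forall x, I x -> (0 <= w x)%E).
Hypothesis wB : forall x, I x ->
  ((\int[mu]_(t in oint x%:E b) w t) * (V x `^ (q / p'))%:E <= B%:E)%E.

Let M0 := hoelder_bound_M.
Let q0 : 0 < q. Proof. exact: lt_le_trans pq. Qed.

(** This is where p <= q enters: the power q/p of the energy of a piece is made linear in that
    energy, the excess exponent being paid by the total M. Linear bounds can then be summed over
    disjoint pieces. *)
Let powM (x : R) : 0 <= x <= M -> x `^ (q / p) <= M `^ (q / p - 1) * x.
Proof.
move=> /andP[x0 xM].
have qp1 : 1 <= q / p by rewrite ler_pdivlMr// mul1r.
have [->|xN0] := eqVneq x 0; first by rewrite mulr0 powR0// gt_eqF// divr_gt0.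
have xp : 0 < x by rewrite lt_neqAle eq_sym xN0.
have -> : x `^ (q / p) = x `^ (q / p - 1) * x.
  rewrite -{3}(powRr1 x0) -powRD ?subrK// xN0; exact: implybT.
by rewrite ler_wpM2r// ge0_ler_powR// ?nnegrE// subr_ge0.
Qed.

Let B0 x : I x -> 0 <= B.
Proof.
move=> Ix; rewrite -lee_fin; apply: le_trans (wB Ix); rewrite mule_ge0//.
  by apply: integral_ge0 => t /(sub_ointr Ix)/w0.
by rewrite lee_fin powR_ge0.
Qed.

(* The lower point is taken at height 2l/3: beyond it F exceeds l/2 strictly,
   which may fail at height l/2 if F is locally constant. *)
Let level l : 0 < l ->
  (((l / 3) `^ q)%:E * (\int[mu]_(x in I `&` [set x | (l < F x)%R]) w x) <=
   (B * M `^ (q / p - 1))%:E * \int[mu]_(x in S (l / 2) l) g x)%E.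
Proof.
case: fgV => -[mf f0 mg g0 gM] V0 fg l0.
have ffin := hoelder_bound_fin.
have mIl : measurable (I `&` [set x | l < F x]).
  rewrite (_ : [set x | l < F x] = F @^-1` `]l, +oo[%classic); first exact: mF.
  by apply/seteqP; split => x/=; rewrite in_itv/= andbT.
have [[x [Ix /= lx]]|none] := pselect (I `&` [set x | l < F x] !=set0); last first.
  move: none => /set0P/negP/negPn/eqP ->; rewrite integral_set0 mule0.
  have [x Ix] : I !=set0 by exact: oint_neq0.
  apply: mule_ge0; first by rewrite lee_fin mulr_ge0 ?powR_ge0// (B0 Ix).
  by apply: integral_ge0 => t [/g0].
have [xl Il Fl] := prim_IVT mf f0 ffin Ix l0 lx.
have [xh Ih Fh] : exists2 y, oint a b y & prim a f y = 2 / 3 * l.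
  by apply: (prim_IVT mf f0 ffin Il) => //; rewrite ?Fl; lra.
have hl : xh < xl.
  rewrite ltNge; apply/negP => /(prim_le mf f0 ffin Il Ih).
  by rewrite Fl Fh; lra.
have subl : oint xh%:E xl%:E `<=` oint a xl%:E.
  move=> t /andP[ht tl]; case/andP : Ih => ah _.
  by rewrite /oint/= (lt_trans ah).
have Ihl : oint xh%:E xl%:E `<=` S (l / 2) l.
  move=> t htl; have It : I t by apply: (sub_ointl Il); exact: subl.
  move: htl => /andP[]; rewrite !lte_fin => ht tl; split => //=.
  have := prim_le mf f0 ffin Ih It (ltW ht); rewrite Fh.
  have := prim_le mf f0 ffin It Il (ltW tl); rewrite Fl -/F.
  by move=> ? ?; apply/andP; split => //; lra.
set J := (\int[mu]_(t in oint xh%:E xl%:E) g t)%E.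
have SI : S (l / 2) l `<=` I by move=> t [].
have JS : (J <= \int[mu]_(x in S (l / 2) l) g x)%E.
  apply: ge0_subset_integral => //; first exact: measurable_oint.
  - exact: mS.
  - by apply: measurable_funS mg => //; exact: mI.
  - by move=> t /SI/g0.
have J0 : (0 <= J)%E by apply: integral_ge0 => t /Ihl/SI/g0.
have JM : (J <= M%:E)%E.
  apply: le_trans JS (le_trans _ gM); apply: ge0_subset_integral => //.
  exact: mS.
have Jfin : J \is a fin_num by rewrite ge0_fin_numE// (le_lt_trans JM)// ltry.
have FhlE : (\int[mu]_(t in oint xh%:E xl%:E) (f t)%:E = (l / 3)%:E)%E.
  have := prim_split mf f0 ffin Ih Il hl; rewrite Fl Fh => E.
  have := congr1 (fun y => y - (2 / 3 * l)%:E)%E E.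
  by rewrite addeAC subee// add0e => <-; rewrite -EFinB; congr EFin; lra.
have := fg _ Il _ (measurable_oint xh%:E xl%:E) subl; rewrite FhlE -/J.
move: JS J0 JM; rewrite -(fineK Jfin); set j := fine J => JS j0 jM lj.
have {}lj : l / 3 <= j `^ p^-1 * V xl `^ p'^-1 by rewrite -lee_fin EFinM.
rewrite !lee_fin in j0 jM.
(* Hoelder on the piece from [xh] to [xl], raised to the power q. *)
have lq : (l / 3) `^ q <= M `^ (q / p - 1) * j * V xl `^ (q / p').
  have l30 : 0 <= l / 3 by lra.
  apply: le_trans (ge0_ler_powR (ltW q0) _ _ lj) _; rewrite ?nnegrE//.
    by rewrite mulr_ge0 ?powR_ge0.
  rewrite powRM ?powR_ge0// -!powRrM [p^-1 * q]mulrC.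
  rewrite [p'^-1 * q]mulrC ler_wpM2r ?powR_ge0//.
  by apply: powM; rewrite j0.
have W0 : (0 <= \int[mu]_(x in I `&` [set x | (l < F x)%R]) w x)%E.
  by apply: integral_ge0 => t [/w0].
set W := (\int[mu]_(x in I `&` [set x | (l < F x)%R]) w x)%E in W0 *.
(* By monotonicity of F, the set F > l lies to the right of [xl], so the condition on the weight is
   used at that single point. *)
have WB : ((V xl `^ (q / p'))%:E * W <= B%:E)%E.
  rewrite muleC; apply: le_trans (wB Il); apply: lee_wpmul2r.
    by rewrite lee_fin powR_ge0.
  apply: ge0_subset_integral; first exact: mIl.
  - exact: measurable_oint.
  - by apply: measurable_funS mw; [exact: mI|exact: sub_ointr].
  - by move=> t /(sub_ointr Il)/w0.
  - move=> t [It /= lt]; case/andP : (It) => _ tb; rewrite /oint/= tb andbT lte_fin.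
    rewrite ltNge; apply/negP => /(prim_le mf f0 ffin It Il).
    by rewrite Fl leNgt lt.
have Mj0 : 0 <= M `^ (q / p - 1) * j by rewrite mulr_ge0 ?powR_ge0.
apply: (@le_trans _ _ ((M `^ (q / p - 1) * j * V xl `^ (q / p'))%:E * W)%E).
  by apply: lee_wpmul2r => //; rewrite lee_fin.
apply: (@le_trans _ _ ((M `^ (q / p - 1) * j)%:E * B%:E)%E).
  by rewrite EFinM -muleA; apply: lee_wpmul2l.
rewrite -EFinM (_ : _ * j * B = B * M `^ (q / p - 1) * j); last by ring.
rewrite EFinM; apply: lee_wpmul2l JS.
by rewrite lee_fin mulr_ge0 ?powR_ge0// (B0 Ix).
Qed.

(** The 6 comes from F <= 2l = 6 (l/3) on the layer from l to 2l, [level] being stated with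
    (l/3)^q. *)
Let K := 6 `^ q * (B * M `^ (q / p - 1)).

Let mFw : measurable_fun I (fun x => (F x `^ q)%:E * w x)%E.
Proof.
apply: emeasurable_funM => //; apply/measurable_EFinP.
exact: (measurableT_comp (measurable_powR q)).
Qed.

Let Fw0 x : I x -> (0 <= (F x `^ q)%:E * w x)%E.
Proof. by move=> Ix; rewrite mule_ge0 ?w0// lee_fin powR_ge0. Qed.

Let SI s t : S s t `<=` I. Proof. by move=> x []. Qed.

Let mg' s t : measurable_fun (S s t) g.
Proof. by case: fgV => -[_ _ mg _ _] _ _; apply: measurable_funS mg => //; exact: mI. Qed.

Let mFw' s t : measurable_fun (S s t) (fun x => (F x `^ q)%:E * w x)%E.
Proof. by apply: measurable_funS mFw => //; exact: mI. Qed.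

Let g0' s t x : S s t x -> (0 <= g x)%E.
Proof. by case: fgV => -[_ _ _ g0 _] _ _ /SI/g0. Qed.

Let Fw0' s t x : S s t x -> (0 <= (F x `^ q)%:E * w x)%E.
Proof. by move=> /SI/Fw0. Qed.

(** Each layer is charged to the energy in the layer just below it, so that stacked layers never
    charge the same part of g twice. *)
Let dyadic l : 0 < l ->
  (\int[mu]_(x in S l (2 * l)) ((F x `^ q)%:E * w x) <=
   K%:E * \int[mu]_(x in S (l / 2) l) g x)%E.
Proof.
move=> l0.
have mw' : measurable_fun (S l (2 * l)) w by apply: measurable_funS mw => //; exact: mI.
apply: (@le_trans _ _ (\int[mu]_(x in S l (2 * l)) (((2 * l) `^ q)%:E * w x))%E).
  apply: ge0_le_integral => //.
  - exact: mS.
  - exact: Fw0'.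
  - exact: mFw'.
  - exact: measurable_funeM.
  - move=> x [Ix /= /andP[lF Fl]]; apply: lee_wpmul2r; first exact: w0.
    by rewrite lee_fin ge0_ler_powR// ?nnegrE ?F0// ?(ltW q0)//; lra.
rewrite ge0_integralZl_EFin//; [|exact: mS|by move=> x /SI/w0|exact: powR_ge0].
have -> : (2 * l) `^ q = 6 `^ q * (l / 3) `^ q.
  by rewrite -powRM//; [congr powR; lra|lra].
rewrite /K !EFinM -!muleA; apply: lee_wpmul2l; first by rewrite lee_fin powR_ge0.
rewrite muleA -EFinM; apply: le_trans (level l0).
apply: lee_wpmul2l; first by rewrite lee_fin powR_ge0.
apply: ge0_subset_integral; first exact: mS.
- rewrite (_ : [set x | l < F x] = F @^-1` `]l, +oo[%classic); first exact: mF.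
  by apply/seteqP; split => x/=; rewrite in_itv/= andbT.
- apply: measurable_funS mw; [exact: mI|by move=> x []].
- by move=> x [/w0].
- by move=> x [Ix /= /andP[lF _]]; split.
Qed.

Let S_cat (x y z : R) : x <= y -> y <= z -> S x z = S x y `|` S y z.
Proof.
move=> xy yz; apply/seteqP; split => t.
  move=> [It /= /andP[xF Fz]]; have [Fy|yF] := leP (F t) y.
    by left; split => //=; rewrite xF.
  by right; split => //=; rewrite yF.
move=> [[It /= /andP[xF Fy]]|[It /= /andP[yF Fz]]]; split => //=.
  by rewrite xF (le_trans Fy).
by rewrite (le_lt_trans xy).
Qed.

Let integral_S_cat (h : R -> \bar R) (x y z : R) : x <= y -> y <= z ->
  measurable_fun (S x z) h -> (forall t, S x z t -> (0 <= h t)%E) ->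
  (\int[mu]_(t in S x z) h t =
   \int[mu]_(t in S x y) h t + \int[mu]_(t in S y z) h t)%E.
Proof.
move=> xy yz mh h0; rewrite (S_cat xy yz) ge0_integral_setU//.
- exact: mS.
- exact: mS.
- by rewrite -S_cat.
- by rewrite -S_cat.
- apply/disj_setPS => t [[_ /= /andP[_ Fy]] [_ /= /andP[yF _]]].
  by move: (lt_le_trans yF Fy); rewrite ltxx.
Qed.

Let dyadics l n : 0 < l ->
  (\int[mu]_(x in S l (2 ^+ n * l)) ((F x `^ q)%:E * w x) <=
   K%:E * \int[mu]_(x in S (l / 2) (2 ^+ n * l / 2)) g x)%E.
Proof.
move=> l0; have [z Iz] : I !=set0 by exact: oint_neq0.
have K0 : (0 <= K%:E)%E by rewrite lee_fin !mulr_ge0 ?powR_ge0// (B0 Iz).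
elim: n => [|n IHn].
  rewrite expr0 mul1r (_ : S l l = set0) ?integral_set0; last first.
    rewrite -subset0 => x [_ /= /andP[lF Fl]].
    by move: (lt_le_trans lF Fl); rewrite ltxx.
  by apply: mule_ge0 => //; apply: integral_ge0 => x; exact: g0'.
have n1 : 1 <= 2 ^+ n :> R by rewrite exprn_ege1// ler1n.
have ll : l <= 2 ^+ n * l by rewrite ler_peMl// ltW.
have d0 : 0 < 2 ^+ n * l by rewrite mulr_gt0// exprn_gt0.
rewrite exprS -mulrA (integral_S_cat ll)//; last 2 first.
- by rewrite ler_peMl ?ler1n// ltW.
- by move=> t; exact: Fw0'.
rewrite [in leRHS](@integral_S_cat _ _ (2 ^+ n * l / 2))//; last 3 first.
- by rewrite ler_pM2r.
- by rewrite ler_pM2r// ler_peMl ?ler1n// ltW.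
- by move=> t; exact: g0'.
rewrite ge0_muleDr; last 2 first.
- by apply: integral_ge0 => x; exact: g0'.
- by apply: integral_ge0 => x; exact: g0'.
apply: leeD => //; rewrite [2 * (2 ^+ n * l) / 2]mulrAC divff// mul1r.
exact: dyadic.
Qed.

Lemma linear_hardy :
  (\int[mu]_(x in I) ((F x `^ q)%:E * w x) <=
   (6 `^ q * (M `^ (q / p - 1) * M) * B)%:E)%E.
Proof.
have [z Iz] : I !=set0 by exact: oint_neq0.
have K0 : (0 <= K%:E)%E by rewrite lee_fin !mulr_ge0 ?powR_ge0// (B0 Iz).
(* Where F = 0 the integrand vanishes because q > 0; the sets [T n] increase to the set F > 0. *)
pose T n := S (2 ^- n) (2 ^+ n).
have -> : (\int[mu]_(x in I) ((F x `^ q)%:E * w x) =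
    \int[mu]_(x in \bigcup_n T n) ((F x `^ q)%:E * w x))%E.
  rewrite [LHS]integral_mkcond [RHS]integral_mkcond; apply: eq_integral => x _.
  rewrite !patchE; case: ifPn => [|/negP]; rewrite inE => Ix; last first.
    by rewrite memNset// => -[n _ /SI].
  have [F00|FN0] := eqVneq (F x) 0.
    by rewrite F00 powR0 ?gt_eqF// mul0e; case: ifP.
  have Fp : 0 < F x by rewrite lt_neqAle eq_sym FN0 F0.
  rewrite mem_set//.
  exists (maxn (Num.bound (F x)) (Num.bound (F x)^-1)) => //; split => //=.
  apply/andP; split; last by apply/ltW/upper_nthrootP; rewrite leq_maxl.
  rewrite -[ltRHS]invrK ltf_pV2 ?posrE ?invr_gt0 ?exprn_gt0//.
  by apply: upper_nthrootP; rewrite leq_maxr.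
have cvgT := @ge0_nondecreasing_set_cvg_integral _ _ R
  (T : (set (measurableTypeR R))^nat) (fun x => (F x `^ q)%:E * w x)%E mu.
have {}cvgT : (\int[mu]_(x in T n) ((F x `^ q)%:E * w x))%E @[n --> \oo] -->
    (\int[mu]_(x in \bigcup_i T i) ((F x `^ q)%:E * w x))%E.
  apply: cvgT.
  - apply/nondecreasing_seqP => n; rewrite subsetEset => x [Ix /= /andP[nF Fn]].
    split => //=; apply/andP; split.
      by rewrite (le_lt_trans _ nF)// lef_pV2 ?posrE ?exprn_gt0// ler_eXn2l ?ltr1n.
    by rewrite (le_trans Fn)// ler_eXn2l ?ltr1n.
  - by move=> n; exact: mS.
  - by move=> n; exact: mFw'.
  - by move=> n x; exact: Fw0'.
rewrite -(cvg_lim _ cvgT)//; apply: lime_le; first by apply/cvg_ex; eexists; exact: cvgT.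
near=> n.
(* Read from its bottom level 2^(-n), [T n] is a stack of 2n dyadic layers. *)
have -> : T n = S (2 ^- n) (2 ^+ (n + n) * 2 ^- n).
  by rewrite /T exprD mulfK// expf_neq0.
have n0 : 0 < 2 ^- n :> R by rewrite invr_gt0 exprn_gt0.
apply: le_trans (dyadics (n + n) n0) _.
rewrite (_ : _ * B = K * M); last by rewrite /K; ring.
rewrite [leRHS](EFinM K M); apply: lee_wpmul2l => //.
case: fgV => -[_ _ mg g0 gM] _ _; apply: le_trans gM.
apply: ge0_subset_integral => //; first exact: mS.
Unshelve. all: by end_near. Qed.

End linear_hardy.

(** * The bilinear inequality by iteration *)

Section bilinear_hardy.
Context {R : realType}.
Local Notation mu := (@lebesgue_measure R).

Lemma integral_mul_indic (E J : set R) (h w : R -> \bar R) :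
  (\int[mu]_(x in E) (h x * (w x * (\1_J x)%:E)) =
   \int[mu]_(x in E `&` J) (h x * w x))%E.
Proof.
rewrite integral_mkcondr; apply: eq_integral => x _; rewrite patchE indicE.
by case: ifP => _; rewrite ?mule1 ?mule0.
Qed.

Definition hardy_cst (p q M : R) := 6 `^ q * (M `^ (q / p - 1) * M).

Lemma hardy_cst_ge0 p q M : 0 <= M -> 0 <= hardy_cst p q M.
Proof. by move=> M0; rewrite /hardy_cst !mulr_ge0 ?powR_ge0. Qed.

Variables (a b : \bar R) (f1 f2 : R -> R) (g1 g2 : R -> \bar R) (V1 V2 : R -> R).
Variables (p1 p2 p1' p2' q M1 M2 B : R) (w : R -> \bar R).
Hypotheses (ab : (a < b)%E)
  (fgV1 : hoelder_bound a b f1 g1 V1 p1 p1' M1)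
  (fgV2 : hoelder_bound a b f2 g2 V2 p2 p2' M2)
  (V1nd : forall x y, oint a b x -> oint a b y -> x <= y -> V1 x <= V1 y)
  (V2nd : forall x y, oint a b x -> oint a b y -> x <= y -> V2 x <= V2 y)
  (p10 : 0 < p1) (p20 : 0 < p2) (p10' : 0 < p1') (p20' : 0 < p2')
  (p1q : p1 <= q) (p2q : p2 <= q)
  (mw : measurable_fun (oint a b) w) (w0 : forall x, oint a b x -> (0 <= w x)%E)
  (wB : forall x, oint a b x ->
    ((\int[mu]_(t in oint x%:E b) w t) *
     (V1 x `^ (q / p1') * V2 x `^ (q / p2'))%:E <= B%:E)%E).

Let q0 : 0 < q. Proof. exact: lt_le_trans p1q. Qed.

Let mF1 : measurable_fun (oint a b) (fun x => (prim a f1 x `^ q)%:E).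
Proof.
apply/measurable_EFinP; apply: (measurableT_comp (measurable_powR q)).
have ffin := hoelder_bound_fin fgV1.
by case: fgV1 => -[mf f0 mg g0 gM] _ _; exact: measurable_prim.
Qed.

Let mw1 : measurable_fun (oint a b) (fun x => (prim a f1 x `^ q)%:E * w x)%E.
Proof. exact: emeasurable_funM. Qed.

(** The number V2(x)^(q/p2') is absorbed into the weight restricted to (x, b). The condition for
    this weight at y only sees w beyond max(x, y); as V1 and V2 are nondecreasing, both can be
    evaluated there, where [wB] applies. *)
Let half x : oint a b x ->
  ((\int[mu]_(t in oint x%:E b) ((prim a f1 t `^ q)%:E * w t)) *
   (V2 x `^ (q / p2'))%:E <= (hardy_cst p1 q M1 * B)%:E)%E.
Proof.
move=> Ix.
have [_ V10 _] := fgV1; have [_ V20 _] := fgV2.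
have sub := sub_ointr Ix.
pose wx t := (w t * (\1_(oint x%:E b) t)%:E)%E.
pose c := V2 x `^ (q / p2').
have c0 : 0 <= c by exact: powR_ge0.
have mwx : measurable_fun (oint a b) wx.
  apply: emeasurable_funM => //; apply/measurable_EFinP.
  by apply: measurable_funTS; apply: measurable_indic; exact: measurable_oint.
have wx0 t : oint a b t -> (0 <= wx t)%E.
  by move=> It; rewrite mule_ge0 ?w0// lee_fin.
have := @linear_hardy _ a b f1 g1 V1 p1 p1' q M1 fgV1 ab
  (fun t => c%:E * wx t)%E B p10 p1q _ _ _.
rewrite -/(hardy_cst p1 q M1).
have -> : (\int[mu]_(t in oint a b) ((prim a f1 t `^ q)%:E * (c%:E * wx t)))%E =
  (c%:E * \int[mu]_(t in oint x%:E b) ((prim a f1 t `^ q)%:E * w t))%E.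
  rewrite -ge0_integralZl_EFin//; last 3 first.
  - exact: measurable_oint.
  - by move=> t /sub It; rewrite mule_ge0 ?w0// lee_fin powR_ge0.
  - by apply: measurable_funS mw1 => //; exact: measurable_oint.
  transitivity (\int[mu]_(t in oint a b) ((c%:E * (prim a f1 t `^ q)%:E) * wx t))%E.
    by apply: eq_integral => t _; rewrite muleCA muleA.
  rewrite integral_mul_indic setIidr//.
  by apply: eq_integral => t _; rewrite muleA.
rewrite muleC; apply.
- exact: measurable_funeM.
- by move=> t It; rewrite mule_ge0 ?wx0// lee_fin.
move=> y Iy.
have suby := sub_ointr Iy.
rewrite ge0_integralZl_EFin//; last 3 first.
- exact: measurable_oint.
- by move=> t /suby /wx0.
- by apply: measurable_funS mwx => //; exact: measurable_oint.
have -> : (\int[mu]_(t in oint y%:E b) wx t =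
    \int[mu]_(t in oint (Num.max x y)%:E b) w t)%E.
  transitivity (\int[mu]_(t in oint y%:E b) (1 * wx t))%E.
    by apply: eq_integral => t _; rewrite mul1e.
  rewrite integral_mul_indic (_ : _ `&` _ = oint (Num.max x y)%:E b).
    by apply: eq_integral => t _; rewrite mul1e.
  apply/seteqP; split => t; rewrite /oint/= !lte_fin gt_max.
    by move=> [/andP[-> ->] /andP[-> _]].
  by move=> /andP[/andP[-> ->] ->].
have Im : oint a b (Num.max x y) by rewrite maxEle; case: ifP.
apply: le_trans (wB Im).
rewrite muleAC muleC; apply: lee_wpmul2l.
  by apply: integral_ge0 => t /(sub_ointr Im)/w0.
rewrite -EFinM lee_fin mulrC ler_pM ?powR_ge0//.
  rewrite ge0_ler_powR ?nnegrE ?V10// ?divr_ge0 ?(ltW q0) ?(ltW p10')//.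
  by rewrite V1nd// le_max lexx orbT.
rewrite ge0_ler_powR ?nnegrE ?V20// ?divr_ge0 ?(ltW q0) ?(ltW p20')//.
by rewrite V2nd// le_max lexx.
Qed.

(* The linear inequality for f2 with the weight F1^q w; its hypothesis [half] is
   the linear inequality for f1 with the weight w restricted to (x, b). *)
Lemma bilinear_hardy :
  (\int[mu]_(x in oint a b) (((prim a f1 x * prim a f2 x) `^ q)%:E * w x) <=
   (hardy_cst p2 q M2 * (hardy_cst p1 q M1 * B))%:E)%E.
Proof.
have := @linear_hardy _ a b f2 g2 V2 p2 p2' q M2 fgV2 ab
  (fun t => (prim a f1 t `^ q)%:E * w t)%E _ p20 p2q mw1 _ half.
rewrite -/(hardy_cst p2 q M2) => H.
apply: le_trans (H _); last first.
  by move=> x Ix; rewrite mule_ge0 ?w0// lee_fin powR_ge0.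
rewrite le_eqVlt; apply/orP; left; apply/eqP; apply: eq_integral => x.
rewrite inE => Ix; rewrite muleA -EFinM mulrC powRM//.
- by case: fgV2 => -[_ f0 _ _ _] _ _; exact: (prim_ge0 f0).
- by case: fgV1 => -[_ f0 _ _ _] _ _; exact: (prim_ge0 f0).
Qed.

End bilinear_hardy.

(** * The topology of the weighted Lebesgue spaces *)

Section complex_functions.
Context {R : realType}.
Implicit Types (x y : R[i]) (I : set R) (h k : R -> R[i]).

Lemma normc_sqrt x : normc x = Num.sqrt (complex.Re x ^+ 2 + complex.Im x ^+ 2).
Proof. by case: x. Qed.

Lemma normc_ge0 x : 0 <= normc x.
Proof. by rewrite normc_sqrt sqrtr_ge0. Qed.

Lemma normcB x y : normc (x - y) = normc (y - x).
Proof. by rewrite -[RHS]normcN opprB. Qed.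

Lemma normc_le x : normc x <= `|complex.Re x| + `|complex.Im x|.
Proof.
rewrite normc_sqrt -(@ler_pXn2r _ 2)// ?nnegrE ?sqrtr_ge0 ?addr_ge0//.
rewrite sqr_sqrtr ?addr_ge0 ?sqr_ge0// sqrrD !real_normK ?num_real//.
by rewrite lerD2r lerDl mulrn_wge0// mulr_ge0.
Qed.

Lemma Re_le_normc x : `|complex.Re x| <= normc x.
Proof. by rewrite normc_sqrt -sqrtr_sqr ler_wsqrtr// lerDl sqr_ge0. Qed.

Lemma Im_le_normc x : `|complex.Im x| <= normc x.
Proof. by rewrite normc_sqrt -sqrtr_sqr ler_wsqrtr// lerDr sqr_ge0. Qed.

Definition cmeas I h := measurable_fun I (fun t => complex.Re (h t)) /\
  measurable_fun I (fun t => complex.Im (h t)).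

Lemma cmeasB I h k : cmeas I h -> cmeas I k -> cmeas I (fun t => h t - k t).
Proof.
move=> [mh1 mh2] [mk1 mk2]; split.
  rewrite (_ : (fun _ => _) = (fun t => complex.Re (h t) - complex.Re (k t))).
    exact: measurable_funB.
  by apply/funext => t; case: (h t) (k t) => ? ? [].
rewrite (_ : (fun _ => _) = (fun t => complex.Im (h t) - complex.Im (k t))).
  exact: measurable_funB.
by apply/funext => t; case: (h t) (k t) => ? ? [].
Qed.

Lemma cmeasM I h k : cmeas I h -> cmeas I k -> cmeas I (fun t => h t * k t).
Proof.
move=> [mh1 mh2] [mk1 mk2]; split.
  rewrite (_ : (fun _ => _) = (fun t => complex.Re (h t) * complex.Re (k t) -
      complex.Im (h t) * complex.Im (k t))).
    by apply: measurable_funB; exact: measurable_funM.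
  by apply/funext => t; case: (h t) (k t) => ? ? [].
rewrite (_ : (fun _ => _) = (fun t => complex.Re (h t) * complex.Im (k t) +
    complex.Im (h t) * complex.Re (k t))).
  by apply: measurable_funD; exact: measurable_funM.
by apply/funext => t; case: (h t) (k t) => ? ? [].
Qed.

Lemma measurable_normc I h : cmeas I h -> measurable_fun I (fun t => normc (h t)).
Proof.
move=> [mh1 mh2]; under eq_fun do rewrite normc_sqrt.
have msqrt : measurable_fun setT (@Num.sqrt R).
  exact: continuous_measurable_fun (@sqrt_continuous R).
apply: (measurableT_comp msqrt).
by apply: measurable_funD; exact: measurable_funX.
Qed.

Lemma measurable_normc_powR I h q : cmeas I h ->
  measurable_fun I (fun t => normc (h t) `^ q).
Proof.
by move=> mh; apply: (measurableT_comp (measurable_powR q)); exact: measurable_normc.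
Qed.

End complex_functions.

(** * Powers of weighted norms as a quasi-norm *)

Section power_integral.
Context {R : realType}.
Local Notation mu := (@lebesgue_measure R).

(** The sum is at most twice the larger term. *)
Lemma powR_add_le (q s t : R) : 0 <= q -> 0 <= s -> 0 <= t ->
  (s + t) `^ q <= 2 `^ q * (s `^ q + t `^ q).
Proof.
move=> q0 s0 t0.
have le_ (x y : R) : 0 <= x -> x <= y -> (x + y) `^ q <= 2 `^ q * (x `^ q + y `^ q).
  move=> x0 xy; have y0 := le_trans x0 xy.
  apply: (@le_trans _ _ ((2 * y) `^ q)).
    by rewrite ge0_ler_powR// ?nnegrE ?addr_ge0 ?mulr_ge0//; lra.
  by rewrite powRM// ler_wpM2l ?powR_ge0// lerDr powR_ge0.
have [st|ts] := leP s t; first exact: le_.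
by rewrite addrC [X in _ * X]addrC le_// ltW.
Qed.

Lemma poweR_inv_le (x : \bar R) (q e : R) : 0 < q -> 0 <= e -> (0 <= x)%E ->
  (x `^ q^-1 <= e%:E)%E = (x <= (e `^ q)%:E)%E.
Proof.
move=> q0 e0; have qV0 : 0 <= q^-1 by rewrite invr_ge0 ltW.
case: x => [r| |]// r0; last by rewrite poweRyr// gt_eqF// invr_gt0.
rewrite poweR_EFin !lee_fin; rewrite lee_fin in r0; apply/idP/idP => h.
  have := ge0_ler_powR (ltW q0) _ _ h; rewrite !nnegrE powR_ge0 => /(_ isT e0).
  by rewrite -powRrM mulVf ?powRr1// gt_eqF.
have := ge0_ler_powR qV0 _ _ h; rewrite !nnegrE powR_ge0 => /(_ r0 isT).
by rewrite -powRrM mulfV ?powRr1// gt_eqF.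
Qed.

Lemma poweR_inv_lt (x : \bar R) (q e : R) : 0 < q -> 0 <= e -> (0 <= x)%E ->
  (x `^ q^-1 < e%:E)%E = (x < (e `^ q)%:E)%E.
Proof.
move=> q0 e0; have qV0 : 0 < q^-1 by rewrite invr_gt0.
case: x => [r| |]// r0; last by rewrite poweRyr// gt_eqF// invr_gt0.
rewrite poweR_EFin !lte_fin; rewrite lee_fin in r0; apply/idP/idP => h.
  have := gt0_ltr_powR q0 _ _ h; rewrite !nnegrE powR_ge0 => /(_ isT e0).
  by rewrite -powRrM mulVf ?powRr1// gt_eqF.
have := gt0_ltr_powR qV0 _ _ h; rewrite !nnegrE powR_ge0 => /(_ r0 isT).
by rewrite -powRrM mulfV ?powRr1// gt_eqF.
Qed.

Variables (I : set R) (q : R).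
Hypotheses (mI : measurable I) (q0 : 0 < q).
Implicit Types (w : R -> \bar R) (h k : R -> R[i]).

(* The q-th power of [wLnorm]. *)
Definition wpow w h : \bar R := (\int[mu]_(x in I) ((normc (h x) `^ q)%:E * w x))%E.

Definition weight w := measurable_fun I w /\ forall x, I x -> (0 <= w x)%E.

Lemma weight_indic w J : measurable J -> weight w ->
  weight (fun x => w x * (\1_J x)%:E)%E.
Proof.
move=> mJ [mw w0]; split => [|x Ix]; last by rewrite mule_ge0 ?w0// lee_fin.
apply: emeasurable_funM => //; apply/measurable_EFinP.
by apply: measurable_funTS; exact: measurable_indic.
Qed.

Lemma wpow_indic w J h : wpow (fun x => w x * (\1_J x)%:E)%E h =
  (\int[mu]_(x in I `&` J) ((normc (h x) `^ q)%:E * w x))%E.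
Proof. by rewrite /wpow integral_mul_indic. Qed.

Lemma measurable_wpow w h : measurable_fun I w -> cmeas I h ->
  measurable_fun I (fun x => (normc (h x) `^ q)%:E * w x)%E.
Proof.
by move=> mw mh; apply: emeasurable_funM => //; apply/measurable_EFinP;
  exact: measurable_normc_powR.
Qed.

Lemma integrand_ge0 w h x : weight w -> I x -> (0 <= (normc (h x) `^ q)%:E * w x)%E.
Proof. by move=> [_ w0] Ix; rewrite mule_ge0 ?w0// lee_fin powR_ge0. Qed.

Lemma wpow_ge0 w h : weight w -> (0 <= wpow w h)%E.
Proof. by move=> ww; apply: integral_ge0 => x; exact: (integrand_ge0 _ ww). Qed.

Lemma wpow_le_weight w w' h : weight w -> weight w' -> cmeas I h ->
  (forall x, I x -> (w x <= w' x)%E) -> (wpow w h <= wpow w' h)%E.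
Proof.
move=> ww ww' mh le; apply: ge0_le_integral => //.
- by move=> x; exact: (integrand_ge0 h ww).
- exact: measurable_wpow ww.1 mh.
- exact: measurable_wpow ww'.1 mh.
- by move=> x Ix; apply: lee_wpmul2l; [rewrite lee_fin powR_ge0|exact: le].
Qed.

Lemma wpowB w h k : wpow w (fun x => h x - k x) = wpow w (fun x => k x - h x).
Proof. by apply: eq_integral => x _; rewrite normcB. Qed.

Lemma wpow_le w h (g : R -> R) : weight w -> cmeas I h -> measurable_fun I g ->
  (forall x, I x -> normc (h x) <= g x) ->
  (wpow w h <= \int[mu]_(x in I) ((g x `^ q)%:E * w x))%E.
Proof.
move=> ww mh mg hg; apply: ge0_le_integral => //.
- by move=> x; exact: (integrand_ge0 _ ww).
- exact: measurable_wpow ww.1 mh.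
- case: ww => mw _; apply: emeasurable_funM => //; apply/measurable_EFinP.
  exact: (measurableT_comp (measurable_powR q)).
- move=> x Ix; case: ww => _ w0; apply: lee_wpmul2r; first exact: w0.
  rewrite lee_fin ge0_ler_powR// ?nnegrE ?normc_ge0 ?hg ?(ltW q0)//.
  by rewrite (le_trans _ (hg _ Ix))// normc_ge0.
Qed.

(* Cheaper than Minkowski's inequality, and sufficient: a quasi-norm determines
   the topology. *)
Lemma wpow_triangle w h k l : weight w -> cmeas I h -> cmeas I k -> cmeas I l ->
  (wpow w (fun x => h x - l x)%R <= (2 `^ q)%:E *
    (wpow w (fun x => h x - k x)%R + wpow w (fun x => k x - l x)%R))%E.
Proof.
move=> ww mh mk ml.
have mhk := cmeasB mh mk; have mkl := cmeasB mk ml.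
have mw := fun h => @measurable_wpow w h ww.1.
have h0 x z : I x -> (0 <= (normc z `^ q)%:E * w x)%E.
  exact: (integrand_ge0 (fun=> z) ww).
rewrite /wpow -ge0_integralD//; last 4 first.
- by move=> x; exact: h0.
- exact: mw mhk.
- by move=> x; exact: h0.
- exact: mw mkl.
rewrite -ge0_integralZl_EFin ?powR_ge0//; last 2 first.
- by move=> x Ix; apply: adde_ge0; exact: h0.
- by apply: emeasurable_funD; [exact: mw mhk|exact: mw mkl].
apply: ge0_le_integral => //.
- by move=> x; exact: h0.
- exact: mw (cmeasB mh ml).
- by apply: measurable_funeM; apply: emeasurable_funD;
    [exact: mw mhk|exact: mw mkl].
- move=> x Ix; case: (ww) => _ w0.
  rewrite -ge0_muleDl ?lee_fin ?powR_ge0// muleA -EFinD -EFinM.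
  apply: lee_wpmul2r; first exact: w0.
  rewrite lee_fin; apply: le_trans (powR_add_le (ltW q0) (normc_ge0 _) (normc_ge0 _)).
  rewrite ge0_ler_powR// ?nnegrE ?normc_ge0 ?addr_ge0 ?normc_ge0 ?(ltW q0)//.
  apply: le_trans (le_normcD _ _).
  by rewrite addrA subrK.
Qed.

Lemma wpow_le_add w h k : weight w -> cmeas I h -> cmeas I k ->
  (wpow w h <= (2 `^ q)%:E *
    (wpow w (fun x => h x - k x)%R + wpow w k))%E.
Proof.
move=> ww mh mk.
have m0 : cmeas I (fun=> 0 : R[i]) by split; exact: measurable_cst.
have := wpow_triangle ww mh mk m0.
have E (g : R -> R[i]) : (fun x => g x - 0) = g.
  by apply/funext => x; rewrite subr0.
by rewrite !E.
Qed.

Lemma wpow_sub_le w h l : weight w -> cmeas I h -> cmeas I l ->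
  (wpow w (fun x => h x - l x)%R <=
   (2 `^ q)%:E * (wpow w h + wpow w l))%E.
Proof.
move=> ww mh ml.
have m0 : cmeas I (fun=> 0 : R[i]) by split; exact: measurable_cst.
have := wpow_triangle ww mh m0 ml.
rewrite [in X in (_ <= _ * (_ + X))%E -> _]wpowB.
have E (g : R -> R[i]) : (fun x => g x - 0) = g.
  by apply/funext => x; rewrite subr0.
by rewrite !E.
Qed.

(** [wae_eq] says nothing where w vanishes, but the integrand is 0 there. *)
Lemma wpow_ae w h k : measurable_fun I w -> cmeas I h -> cmeas I k ->
  wae_eq I w h k -> wpow w h = wpow w k.
Proof.
move=> mw mh mk hk; apply: ae_eq_integral; [by []|exact: measurable_wpow mw mh|
  exact: measurable_wpow mw mk|].
move: hk; apply: ae_imply => x /= hk Ix.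
have [->|w0] := eqVneq (w x) 0%E; first by rewrite !mule0.
by rewrite hk.
Qed.

Lemma wae_eqB w h h' k k' : wae_eq I w h h' -> wae_eq I w k k' ->
  wae_eq I w (fun x => h x - k x) (fun x => h' x - k' x).
Proof.
move=> hh kk; have := @filterI _ _ (ae_filter_ringOfSetsType mu) _ _ hh kk.
by apply: ae_imply => x [H1 H2] Ix; rewrite H1// H2.
Qed.

Lemma wLnorm_lt w h (e : R) : weight w -> 0 <= e ->
  (wLnorm I w q h < e%:E)%E = (wpow w h < (e `^ q)%:E)%E.
Proof. by move=> ww e0; rewrite /wLnorm poweR_inv_lt//; exact: wpow_ge0. Qed.

End power_integral.

Section wLspace_topology.
Context {R : realType}.
Local Notation mu := (@lebesgue_measure R).
Variables (F : scalars) (I : set R) (w : R -> \bar R) (q : R).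
Hypotheses (mI : measurable I) (q0 : 0 < q) (ww : weight I w).

Local Notation Y := (wLspace F I w q).
Local Notation N := (wpow I q w).

Lemma cmeas_wL (f : Y) : cmeas I f.
Proof. by rewrite /wLspace_to_fun; case: (repr f) => /= g []. Qed.

Lemma wpow_lty (f : Y) : (N f < +oo)%E.
Proof.
rewrite /wLspace_to_fun; case: (repr f) => /= g [_ _ _]; rewrite /wLnorm => gfin.
by apply: lty_poweRy gfin; rewrite gt_eqF// invr_gt0.
Qed.

Lemma wLballE (f : Y) (e : R) (g : Y) : 0 <= e ->
  wLball f e g <-> (N (fun x => f x - g x)%R < (e `^ q)%:E)%E.
Proof. by move=> e0; rewrite /wLball/= wLnorm_lt. Qed.

Lemma wLball_center (f : Y) (e : R) : 0 < e -> wLball f e f.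
Proof.
move=> e0; apply: (wLballE f f (ltW e0)).2.
rewrite /wpow integral0_eq ?lte_fin ?powR_gt0// => x _.
by rewrite subrr Normc.normc0 powR0 ?gt_eqF// mul0e.
Qed.

Lemma wLball_sym (f g : Y) (e : R) : 0 <= e -> wLball f e g -> wLball g e f.
Proof.
move=> e0 fg; apply: (wLballE g f e0).2.
by have := (wLballE f g e0).1 fg; rewrite wpowB.
Qed.

Lemma wLball_split (e : R) : 0 < e -> exists2 d : R, 0 < d &
  forall f g h : Y, wLball f d g -> wLball g d h -> wLball f e h.
Proof.
(* K is chosen so that d = e / K satisfies 2^q (d^q + d^q) = e^q, which cancels the constant of
   [wpow_triangle]. *)
move=> e0; pose K : R := (2 * 2 `^ q) `^ q^-1.
have KK0 : 0 < 2 * 2 `^ q :> R by rewrite mulr_gt0// powR_gt0.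
have K0 : 0 < K by rewrite powR_gt0.
have Kq : K `^ q = 2 * 2 `^ q by rewrite -powRrM mulVf ?powRr1 ?gt_eqF// ltW.
have d0 : 0 < e / K by rewrite divr_gt0.
have dq : (e / K) `^ q = e `^ q / (2 * 2 `^ q).
  rewrite powRM ?invr_ge0 ?(ltW e0) ?(ltW K0)//.
  by rewrite -powR_inv1 ?(ltW K0)// powRAC Kq powR_inv1// ltW.
exists (e / K) => // f g h.
move=> /(wLballE f g (ltW d0)).1 fg /(wLballE g h (ltW d0)).1 gh.
apply: (wLballE f h (ltW e0)).2.
apply: le_lt_trans (wpow_triangle mI q0 ww (cmeas_wL f) (cmeas_wL g) (cmeas_wL h)) _.
have -> : ((e `^ q)%:E = (2 `^ q)%:E * (((e / K) `^ q)%:E + ((e / K) `^ q)%:E))%E.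
  by rewrite -EFinD -EFinM dq; congr EFin; field; rewrite gt_eqF// powR_gt0.
move: (wpow _ _ _ _) (wpow _ _ _ _) fg gh => x y xlt ylt.
by rewrite lte_pmul2l ?lte_fin ?powR_gt0// lteD.
Qed.

(** The topology is given by its open sets only; that balls form a neighbourhood base has to be
    recovered from the quasi-triangle inequality. *)
Lemma nbhs_wLball (f : Y) (U : set Y) :
  nbhs f U <-> exists2 e : R, 0 < e & wLball f e `<=` U.
Proof.
split.
  rewrite nbhsE => -[V [oV Vf] VU].
  have [e e0 eV] : exists2 e : R, 0 < e & wLball f e `<=` V := oV f Vf.
  by exists e => //; exact: subset_trans VU.
move=> [e e0 eU]; rewrite nbhsE.
(* Without the triangle inequality, balls need not be open. *)
pose V : set Y := [set g | exists2 d : R, 0 < d & wLball g d `<=` U].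
exists V; last by move=> g [d d0]; apply; exact: wLball_center.
split; last by exists e.
suff : wLopen V by [].
move=> g [d d0 dU]; have [c c0 cP] := wLball_split d0.
exists c => // h gh; exists c => // k hk; apply: dU; exact: cP gh hk.
Qed.

(** Only elements of A come as T f g. A filter G on the closure is therefore replaced by an
    ultrafilter that contains A and stays close to every member of G; its limit is a cluster point
    of G. *)
Lemma compact_closure_ultra (A : set Y) :
  (forall U : set_system Y, UltraFilter U -> U A -> exists h : Y, U --> h) ->
  compact (closure A).
Proof.
move=> HA G PG GA.
(* Fattening the members of G moves the filter from the closure of A to A. *)
pose fat (S : set Y) (e : R) : set Y := [set z | exists2 y, S y & wLball y e z].
pose B := filter_from [set Se : set Y * R | G Se.1 /\ 0 < Se.2]
  (fun Se => A `&` fat Se.1 Se.2).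
have FB : ProperFilter B.
  apply: filter_from_proper; first apply: filter_from_filter.
  - by exists (setT, 1); split => //=; exact: filterT.
  - move=> [S e] [T d] [/= GS e0] [GT d0]; exists (S `&` T, Num.min e d).
      by split => /=; [exact: filterI|rewrite lt_min e0].
    move=> z [Az [y [/= Sy Ty] yz]]; split; split => //; exists y => //=.
      by rewrite /wLball/= (lt_le_trans yz)// lee_fin ge_min lexx.
    by rewrite /wLball/= (lt_le_trans yz)// lee_fin ge_min lexx orbT.
  - move=> [S e] [/= GS e0].
    (* A member of G meets the closure of A, so its fattening meets A itself. *)
    have [y [Sy cAy]] := filter_ex (filterI GS GA).
    have /cAy[z [Az yz]] : nbhs y (wLball y e) by apply/nbhs_wLball; exists e.
    by exists z; split => //; exists y.
have [U [UU BU]] := ultraFilterLemma FB.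
have UA : U A.
  by apply: BU; exists (setT, 1) => [|z []//]; split => //=; exact: filterT.
have [h Uh] := HA U UU UA.
have clh : cluster G h.
  move=> S V GS /nbhs_wLball[e e0 eV].
  have [d d0 dP] := wLball_split e0.
  have U1 : U (wLball h d) by apply: Uh; apply/nbhs_wLball; exists d.
  have U2 : U (fat S d) by apply: BU; exists (S, d) => // z [].
  have [z [hz [y Sy yz]]] := filter_ex (filterI U1 U2).
  exists y; split => //; apply: eV; apply: dP hz _.
  by apply: wLball_sym => //; exact: ltW.
exists h; split => //.
by apply: closed_closure => V Vh; have [y [? ?]] := clh _ _ GA Vh; exists y.
Qed.

End wLspace_topology.

(** * Bounds on the Hardy operator *)

Section dominated_primitive.
Context {R : realType}.
Local Notation mu := (@lebesgue_measure R).
Variables (a b : \bar R) (f r : R -> R).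
Hypotheses (ab : (a < b)%E) (mf : measurable_fun (oint a b) f)
  (f0 : forall x, oint a b x -> 0 <= f x)
  (ffin : forall x, oint a b x -> (\int[mu]_(t in oint a x%:E) (f t)%:E < +oo)%E)
  (mr : measurable_fun (oint a b) r)
  (rf : forall x, oint a b x -> `|r x| <= f x).

Let intf x : oint a b x -> mu.-integrable (oint a x%:E) (EFin \o f).
Proof.
move=> Ix; apply/integrableP; split.
  apply/measurable_EFinP; apply: measurable_funS mf; first exact: measurable_oint.
  exact: sub_ointl.
rewrite [ltLHS](_ : _ = \int[mu]_(t in oint a x%:E) (f t)%:E)%E; first exact: ffin.
by apply: eq_integral => t; rewrite inE => /(sub_ointl Ix) It; rewrite gee0_abs// lee_fin f0.
Qed.

Let intr x : oint a b x -> mu.-integrable (oint a x%:E) (EFin \o r).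
Proof.
move=> Ix; apply: le_integrable (intf Ix); first exact: measurable_oint.
  apply/measurable_EFinP; apply: measurable_funS mr; first exact: measurable_oint.
  exact: sub_ointl.
move=> t /(sub_ointl Ix) It /=; rewrite lee_fin (le_trans (rf It))//.
exact: ler_norm.
Qed.

(* Both f + r and f - r are nonnegative, hence have nondecreasing primitives. *)
Let primD x : oint a b x -> prim a (f \+ r)%R x = prim a f x + prim a r x.
Proof.
by move=> Ix; apply: RintegralD; [exact: measurable_oint|exact: intf|exact: intr].
Qed.

Let primB x : oint a b x -> prim a (f \- r)%R x = prim a f x - prim a r x.
Proof.
by move=> Ix; apply: RintegralB; [exact: measurable_oint|exact: intf|exact: intr].
Qed.

Let D0 x : oint a b x -> 0 <= (f \+ r)%R x.
Proof. by move=> /rf; rewrite ler_norml => /andP[+ _] /=; lra. Qed.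

Let B0 x : oint a b x -> 0 <= (f \- r)%R x.
Proof. by move=> /rf; rewrite ler_norml subr_ge0 => /andP[]. Qed.

Let fin_aux (h : R -> R) x : oint a b x -> mu.-integrable (oint a x%:E) (EFin \o h) ->
  (\int[mu]_(t in oint a x%:E) (h t)%:E < +oo)%E.
Proof.
move=> Ix inth; have : (\int[mu]_(t in oint a x%:E) (h t)%:E)%E \is a fin_num.
  by apply: integrable_fin_num inth; exact: measurable_oint.
by move=> /fin_numPlt/andP[].
Qed.

Let Dfin x : oint a b x -> (\int[mu]_(t in oint a x%:E) ((f \+ r) t)%:E < +oo)%E.
Proof.
move=> Ix; apply: fin_aux => //.
by apply: integrableD (intf Ix) (intr Ix); exact: measurable_oint.
Qed.

Let Bfin x : oint a b x -> (\int[mu]_(t in oint a x%:E) ((f \- r) t)%:E < +oo)%E.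
Proof.
move=> Ix; apply: fin_aux => //.
by apply: integrableB (intf Ix) (intr Ix); exact: measurable_oint.
Qed.

Lemma norm_prim_le x : oint a b x -> `|prim a r x| <= prim a f x.
Proof.
move=> Ix; rewrite ler_norml; apply/andP; split.
  by have := prim_ge0 D0 Ix; rewrite primD//; lra.
by have := prim_ge0 B0 Ix; rewrite primB// subr_ge0.
Qed.

Lemma dist_prim_le x y : oint a b x -> oint a b y -> x <= y ->
  `|prim a r y - prim a r x| <= prim a f y - prim a f x.
Proof.
move=> Ix Iy xy.
have := prim_le (measurable_funD mf mr) D0 Dfin Ix Iy xy; rewrite !primD//.
have := prim_le (measurable_funB mf mr) B0 Bfin Ix Iy xy; rewrite !primB//.
by rewrite ler_norml => ? ?; apply/andP; split; lra.
Qed.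

(** The increments of the primitive of r are dominated by those of the continuous primitive of f, so
    it is continuous as well. *)
Lemma measurable_prim_dominated : measurable_fun (oint a b) (prim a r).
Proof.
apply: open_continuous_measurable_fun; first exact: open_oint.
move=> x; rewrite inE => Ix; apply/cvgrPdist_le => e e0.
have /cvgrPdist_le/(_ e e0) cf := prim_continuous mf f0 ffin (mem_set Ix).
have nI : \forall y \near x, oint a b y.
  by apply: open_nbhs_nbhs; split => //; exact: open_oint.
near=> y.
have Iy : oint a b y by near: y.
have fe : `|prim a f x - prim a f y| <= e by near: y.
apply: le_trans fe; have [xy|/ltW yx] := leP x y.
  by rewrite distrC (le_trans (dist_prim_le Ix Iy xy))// distrC ler_norm.
by rewrite (le_trans (dist_prim_le Iy Ix yx))// ler_norm.
Unshelve. all: by end_near. Qed.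

End dominated_primitive.

Section hardy_bounds.
Context {R : realType}.
Local Notation mu := (@lebesgue_measure R).
Variables (a b : \bar R) (v : R -> \bar R) (p p' : R).
Hypotheses (ab : (a < b)%E) (mv : measurable_fun (oint a b) v)
  (vpos : {ae mu, forall x, oint a b x -> (0 < v x < +oo)%E})
  (p1 : 1 < p) (pp' : p^-1 + p'^-1 = 1)
  (Vfin : forall x, oint a b x -> (wV a v p' x < +oo)%E).
Local Notation I := (oint a b).
Local Notation s := (fun t => v t `^ (1 - p'))%E.
Definition wVr (x : R) : R := fine (wV a v p' x).

Let p0 : 0 < p. Proof. exact: lt_trans p1. Qed.
Let p'0 : 0 < p'. Proof. by have [] := conj_exponent p1 pp'. Qed.

Let ms : measurable_fun I s.
Proof. exact: (measurableT_comp (measurable_poweR _)). Qed.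
Let s0 x : I x -> (0 <= s x)%E. Proof. by move=> _; exact: poweR_ge0. Qed.

Lemma wVr_ge0 x : 0 <= wVr x.
Proof. by rewrite fine_ge0// integral_ge0// => t _; exact: poweR_ge0. Qed.

Lemma wVrE x : I x -> (wVr x)%:E = wV a v p' x.
Proof.
move=> Ix; rewrite /wVr fineK// ge0_fin_numE ?Vfin//.
by apply: integral_ge0 => t _; exact: poweR_ge0.
Qed.

Lemma wVr_le x y : I x -> I y -> x <= y -> wVr x <= wVr y.
Proof.
move=> Ix Iy xy; rewrite -lee_fin !wVrE//; apply: ge0_subset_integral.
- exact: measurable_oint.
- exact: measurable_oint.
- by apply: measurable_funS ms; [exact: measurable_oint|exact: sub_ointl].
- by move=> t _; exact: poweR_ge0.
- by move=> t /andP[at_ tx]; rewrite /oint/= at_ (lt_le_trans tx).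
Qed.

Section one_function.
Variables (f : R -> R[i]) (M : R).
Hypotheses (mf : cmeas I f) (fM : (wpow I p v f <= M%:E)%E).
Local Notation nf := (fun t => normc (f t)).
Local Notation g := (fun t => (nf t `^ p)%:E * `|v t|)%E.

Let mnf : measurable_fun I nf. Proof. exact: measurable_normc. Qed.
Let nf0 x : I x -> 0 <= nf x. Proof. by move=> _; exact: normc_ge0. Qed.
Let mg : measurable_fun I g.
Proof.
apply: emeasurable_funM; last exact: measurableT_comp.
by apply/measurable_EFinP; exact: measurable_normc_powR.
Qed.
Let g0 x : I x -> (0 <= g x)%E.
Proof. by move=> _; rewrite mule_ge0// lee_fin powR_ge0. Qed.

Let gM : (\int[mu]_(x in I) g x <= M%:E)%E.
Proof.
apply: le_trans fM; rewrite le_eqVlt; apply/orP; left; apply/eqP.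
apply: ae_eq_integral => //.
- exact: measurable_oint.
- exact: measurable_wpow mv mf.
- move: vpos; apply: ae_imply => x /[swap] Ix /(_ Ix) /andP[vx _].
  by rewrite gee0_abs// ltW.
Qed.

Let M0 : 0 <= M.
Proof. by rewrite -lee_fin (le_trans _ gM)//; exact: integral_ge0. Qed.

(** Here the energy of f is replaced by its bound M and the integral of v^(1 - p') stays local,
    which yields equicontinuity. [hoelder_bound_normc] makes the opposite choice: the energy stays
    local, so that it can be summed over pieces. *)
Lemma integral_normc_le A : measurable A -> A `<=` I ->
  (\int[mu]_(t in A) (normc (f t))%:E <=
   (M `^ p^-1)%:E * (\int[mu]_(t in A) s t) `^ p'^-1)%E.
Proof.
move=> mA AI.
have mI : measurable I by exact: measurable_oint.
apply: le_trans (weighted_hoelder p1 pp' mA (measurable_funS mI AI mnf) _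
  (measurable_funS mI AI mv) _) _.
- by move=> x _; exact: normc_ge0.
- by move: vpos; apply: ae_imply => x H /AI.
apply: lee_wpmul2r; first exact: poweR_ge0.
have A0 : (0 <= \int[mu]_(x in A) g x)%E by apply: integral_ge0 => x /AI/g0.
have AM : (\int[mu]_(x in A) g x <= M%:E)%E.
  by apply: le_trans gM; exact: ge0_subset_integral.
rewrite -poweR_EFin; apply: gt0_ler_poweR AM.
- by rewrite invr_ge0 ltW.
- by rewrite in_itv/= A0 leey.
- by rewrite in_itv/= lee_fin M0 leey.
Qed.

Lemma hoelder_bound_normc : hoelder_bound a b nf g wVr p p' M.
Proof.
split; [by split|by move=> x _; exact: wVr_ge0|move=> x Ix A mA Ax].
have mI : measurable I by exact: measurable_oint.
have AI : A `<=` I by exact: subset_trans Ax (sub_ointl Ix).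
apply: le_trans (weighted_hoelder p1 pp' mA (measurable_funS mI AI mnf) _
  (measurable_funS mI AI mv) _) _.
- by move=> t _; exact: normc_ge0.
- by move: vpos; apply: ae_imply => t H /AI.
apply: lee_wpmul2l; first exact: poweR_ge0.
have AV : (\int[mu]_(t in A) s t <= (wVr x)%:E)%E.
  rewrite wVrE//; apply: ge0_subset_integral => //; first exact: measurable_oint.
  - by apply: measurable_funS ms => //; exact: sub_ointl.
  - by move=> t _; exact: poweR_ge0.
rewrite -poweR_EFin; apply: gt0_ler_poweR AV.
- by rewrite invr_ge0 ltW.
- by rewrite in_itv/= integral_ge0 ?leey// => t _; exact: poweR_ge0.
- by rewrite in_itv/= lee_fin wVr_ge0 leey.
Qed.

Let ffin x : I x -> (\int[mu]_(t in oint a x%:E) (nf t)%:E < +oo)%E.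
Proof. exact: (hoelder_bound_fin hoelder_bound_normc). Qed.

Let mRe : measurable_fun I (fun t => complex.Re (f t)). Proof. by case: mf. Qed.
Let mIm : measurable_fun I (fun t => complex.Im (f t)). Proof. by case: mf. Qed.

Lemma cmeas_hardy : cmeas I (hardy a f).
Proof.
split.
  apply: (@measurable_prim_dominated _ a b nf) => // x _; exact: Re_le_normc.
apply: (@measurable_prim_dominated _ a b nf) => // x _; exact: Im_le_normc.
Qed.

(** The real and the imaginary part are each dominated by the primitive of |f|, whence the factor
    2. *)
Lemma normc_hardy_le x : I x -> normc (hardy a f x) <= 2 * prim a nf x.
Proof.
move=> Ix; apply: le_trans (normc_le _) _; rewrite mulr2n mulrDl mul1r.
apply: lerD.
  apply: (@norm_prim_le _ a b nf) => // y _; exact: Re_le_normc.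
apply: (@norm_prim_le _ a b nf) => // y _; exact: Im_le_normc.
Qed.

Lemma measurable_prim_normc : measurable_fun I (prim a nf).
Proof. exact: measurable_prim. Qed.

Lemma prim_normc_ge0 x : I x -> 0 <= prim a nf x.
Proof. exact: prim_ge0. Qed.

Lemma prim_normc_le x : I x -> prim a nf x <= M `^ p^-1 * wVr x `^ p'^-1.
Proof.
move=> Ix; rewrite -lee_fin (primE nf0 ffin)//.
apply: le_trans (integral_normc_le (measurable_oint _ _) (sub_ointl Ix)) _.
by rewrite EFinM -(poweR_EFin (wVr x)) wVrE.
Qed.

(** The modulus of continuity depends on f only through M, hence is common to all functions of the
    unit ball. *)
Lemma hardy_dist_le x y (e : R) : I x -> I y -> 0 <= e ->
  (\int[mu]_(t in oint (Num.min x y)%:E (Num.max x y)%:E) s t <= e%:E)%E ->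
  `|complex.Re (hardy a f x) - complex.Re (hardy a f y)| <= M `^ p^-1 * e `^ p'^-1 /\
  `|complex.Im (hardy a f x) - complex.Im (hardy a f y)| <= M `^ p^-1 * e `^ p'^-1.
Proof.
move=> Ix Iy e0; wlog xy : x y Ix Iy / x <= y => [H|].
  have [xy|yx] := orP (le_total x y); first exact: H.
  rewrite minC maxC => /(H _ _ Iy Ix yx)[Hr Hi].
  by rewrite distrC; split => //; rewrite distrC.
rewrite min_l// max_r// => se.
have key : prim a nf y - prim a nf x <= M `^ p^-1 * e `^ p'^-1.
  move: xy; rewrite le_eqVlt => /predU1P[->|xy].
    by rewrite subrr mulr_ge0 ?powR_ge0.
  have E := prim_split mnf nf0 ffin Ix Iy xy.
  rewrite -lee_fin EFinB E addeAC subee// add0e.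
  have sub : oint x%:E y%:E `<=` I.
    move=> t /andP[xt ty]; case/andP: Ix => ax _; case/andP: Iy => _ yb.
    by rewrite /oint/= (lt_trans ax)// (lt_trans ty).
  apply: le_trans (integral_normc_le (measurable_oint _ _) sub) _.
  rewrite EFinM; apply: lee_wpmul2l; first by rewrite lee_fin powR_ge0.
  rewrite -poweR_EFin; apply: gt0_ler_poweR se.
  - by rewrite invr_ge0 ltW.
  - by rewrite in_itv/= integral_ge0 ?leey// => t _; exact: poweR_ge0.
  - by rewrite in_itv/= lee_fin e0 leey.
split; apply: le_trans key; rewrite distrC.
  apply: (@dist_prim_le _ a b nf) => // z _; exact: Re_le_normc.
apply: (@dist_prim_le _ a b nf) => // z _; exact: Im_le_normc.
Qed.

End one_function.
End hardy_bounds.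

Section quotient_representatives.
Context {R : realType}.
Local Notation mu := (@lebesgue_measure R).

(** A class is turned into a function by [repr], which returns g only up to [wae_eq]. *)
Lemma pi_wae (F : scalars) (I : set R) (w : R -> \bar R) (p : R) (g : R -> R[i])
  (H : is_wLfun F I w p g) :
  wae_eq I w (\pi_(wLspace F I w p) (WLfun H) : wLspace F I w p)%qT g.
Proof.
have : (\pi_(wLspace F I w p) (repr (\pi_(wLspace F I w p) (WLfun H))) =
  \pi_(wLspace F I w p) (WLfun H))%qT by rewrite reprK.
by move=> /eqmodP/asboolP.
Qed.

Lemma eq_hardy (a b : \bar R) (h k : R -> R[i]) (y : R) :
  {ae mu, forall x, oint a b x -> h x = k x} ->
  cmeas (oint a b) h -> cmeas (oint a b) k -> oint a b y -> hardy a h y = hardy a k y.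
Proof.
move=> hk [mh1 mh2] [mk1 mk2] Iy.
have sub := sub_ointl Iy.
have mI := @measurable_oint R a b.
congr Complex; congr fine; apply: ae_eq_integral.
- exact: measurable_oint.
- by apply/measurable_EFinP; apply: measurable_funS mh1.
- by apply/measurable_EFinP; apply: measurable_funS mk1.
- by move: hk; apply: ae_imply => x hk /sub/hk ->.
- exact: measurable_oint.
- by apply/measurable_EFinP; apply: measurable_funS mh2.
- by apply/measurable_EFinP; apply: measurable_funS mk2.
- by move: hk; apply: ae_imply => x hk /sub/hk ->.
Qed.

End quotient_representatives.

(** * Extremal functions *)

Section test_function.
Context {R : realType}.
Local Notation mu := (@lebesgue_measure R).
Variables (F : scalars) (a b : \bar R) (v : R -> \bar R) (p p' : R).
Hypotheses (ab : (a < b)%E) (mv : measurable_fun (oint a b) v)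
  (vpos : {ae mu, forall x, oint a b x -> (0 < v x < +oo)%E})
  (p1 : 1 < p) (pp' : p^-1 + p'^-1 = 1)
  (Vfin : forall x, oint a b x -> (wV a v p' x < +oo)%E).
Local Notation I := (oint a b).
Local Notation V := (wVr a v p').

(* The extremal function v^(1 - p') 1_(a, x) V(x)^(-1/p); if V(x) = 0, it vanishes
   since [0 `^ (- p^-1) = 0]. *)
Lemma test_function x : I x -> exists f : wLspace F I v p,
  wLclosed_unit_ball f /\
  forall y, I y -> x <= y -> hardy a f y = Complex (V x `^ p'^-1) 0.
Proof.
move=> Ix.
have [p'0 E1 E2] := conj_exponent p1 pp'.
have p0 : 0 < p by rewrite (lt_trans ltr01).
have mI : measurable I by exact: measurable_oint.
have mx : measurable (oint a x%:E) by exact: measurable_oint.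
have sub := sub_ointl Ix.
pose c := V x `^ (- p^-1).
pose sg t := fine (v t `^ (1 - p'))%E.
have msg : measurable_fun I sg.
  apply: measurableT_comp => //.
  exact: (measurableT_comp (measurable_poweR _)).
have sg0 t : 0 <= sg t by rewrite fine_ge0// poweR_ge0.
pose r t : R := c * sg t * \1_(oint a x%:E) t.
have c0 : 0 <= c by exact: powR_ge0.
have r0 t : 0 <= r t by rewrite !mulr_ge0.
have mr : measurable_fun I r.
  apply: measurable_funM; first exact: measurable_funM.
  by apply: measurable_funTS; exact: measurable_indic.
pose f t : R[i] := Complex (r t) 0.
have mf : cmeas I f by split => //=; exact: measurable_cst.
have nf t : normc (f t) = r t.
  by rewrite normc_sqrt /= expr0n/= addr0 sqrtr_sqr ger0_norm.
have V0 : 0 <= V x by exact: wVr_ge0.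
have cV1 : c `^ p * V x <= 1.
  rewrite /c -powRrM mulNr mulVf ?gt_eqF// .
  have [->|VN0] := eqVneq (V x) 0; first by rewrite mulr0.
  by rewrite powR_inv1// mulVf.
have intsg : (\int[mu]_(t in oint a x%:E) (sg t)%:E = (V x)%:E)%E.
  rewrite (wVrE Vfin Ix); apply: ae_eq_integral => //.
  - by apply/measurable_EFinP; exact: measurable_funS msg.
  - by apply: measurable_funS mI sub _; exact: (measurableT_comp (measurable_poweR _)).
  - move: vpos; apply: ae_imply => t H /sub/H; rewrite /sg.
    by case: (v t) => [s| |]//= /andP[].
have wf : (wpow I p v f <= 1)%E.
  rewrite (_ : wpow I p v f = (c `^ p)%:E * (V x)%:E)%E; first by rewrite -EFinM lee_fin.
  rewrite -intsg -ge0_integralZl_EFin ?powR_ge0//; last 2 first.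
  - by move=> t _; rewrite lee_fin.
  - by apply/measurable_EFinP; exact: measurable_funS msg.
  transitivity (\int[mu]_(t in I)
     (((c * sg t) `^ p)%:E * (v t * (\1_(oint a x%:E) t)%:E)))%E.
    apply: eq_integral => t _; rewrite nf /r indicE.
    case: (t \in _); first by rewrite !mulr1 mule1.
    by rewrite mulr0 powR0 ?gt_eqF// !mule0 mul0e.
  rewrite integral_mul_indic setIidr//; apply: ae_eq_integral => //.
  - apply: emeasurable_funM; last exact: measurable_funS mv.
    apply/measurable_EFinP; apply: (measurableT_comp (measurable_powR p)).
    by apply: measurable_funM => //; exact: measurable_funS msg.
  - by apply: measurable_funeM; apply/measurable_EFinP; exact: measurable_funS msg.
  - move: vpos; apply: ae_imply => t H /sub/H; rewrite /sg.
    case: (v t) => [s| |]//=; case/andP=> + _ //; rewrite lte_fin => s0.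
    rewrite -!EFinM; congr EFin.
    rewrite powRM ?powR_ge0// -mulrA; congr (_ * _).
    rewrite -{2}(powRr1 (ltW s0)) -powRrM -powRD ?E2//.
    by rewrite (gt_eqF s0) implybT.
have Hf : is_wLfun F I v p f.
  split; [by case: mf|by case: mf|by case: F|].
  rewrite /wLnorm -/(wpow I p v f); apply: poweR_lty.
  by apply: le_lt_trans wf _; rewrite ltry.
pose g : wLspace F I v p := (\pi_(wLspace F I v p) (WLfun Hf))%qT.
have fpi : wae_eq I v g f by exact: pi_wae Hf.
(* [wae_eq] ignores the zeros of v; as v > 0 almost everywhere, it is plain almost everywhere
   equality here. *)
have fg : {ae mu, forall t, I t -> g t = f t}.
  have := @filterI _ _ (ae_filter_ringOfSetsType mu) _ _ fpi vpos.
  apply: ae_imply => t [H1 H2] It; apply: H1; split => //=.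
  by case/andP: (H2 It) => ? _; rewrite gt_eqF.
have mg : cmeas I g by exact: cmeas_wL.
exists g; split.
  rewrite /wLclosed_unit_ball/= /wLnorm -/(wpow I p v g).
  rewrite (wpow_ae _ mI mv mg mf fpi).
  (* v may be negative on a null set, so the sign is read off after replacing v by |v|. *)
  have w0 : (0 <= wpow I p v f)%E.
    rewrite (_ : wpow I p v f = wpow I p (fun t => `|v t|%E) f).
      by apply: integral_ge0 => t _; rewrite mule_ge0// lee_fin powR_ge0.
    apply: ae_eq_integral => //; first exact: measurable_wpow.
      by apply: measurable_wpow => //; exact: measurableT_comp.
    move: vpos; apply: ae_imply => t H /H /andP[vt _].
    by rewrite gee0_abs// ltW.
  by rewrite poweR_inv_le// ?powR1.
move=> y Iy xy; rewrite (eq_hardy fg mg mf Iy).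
rewrite /hardy/=; congr Complex; last by rewrite /Rintegral integral0.
rewrite /Rintegral.
have -> : (\int[mu]_(t in oint a y%:E) (r t)%:E =
   \int[mu]_(t in oint a y%:E) (c%:E * ((sg t)%:E * (\1_(oint a x%:E) t)%:E)))%E.
  by apply: eq_integral => t _; rewrite /r -mulrA !EFinM.
rewrite (integral_mul_indic _ _ (fun=> c%:E)) setIidr; last first.
  by move=> t /andP[at_ tx]; rewrite /oint/= at_ (lt_le_trans tx).
rewrite ge0_integralZl_EFin//; last 2 first.
- by move=> t _; rewrite lee_fin.
- by apply/measurable_EFinP; exact: measurable_funS msg.
rewrite intsg -EFinM /= /c.
(* For V(x) > 0, c V(x) = V(x)^(1 - 1/p) = V(x)^(1/p'); for V(x) = 0 both sides vanish. *)
have [->|VN0] := eqVneq (V x) 0; first by rewrite mulr0 powR0// gt_eqF// invr_gt0.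
rewrite -{2}(powRr1 V0) -powRD ?VN0 ?implybT//.
by congr powR; rewrite -pp'; ring.
Qed.

End test_function.

(** * Necessity *)

Section uniform_tails.
Context {R : realType}.
Local Notation mu := (@lebesgue_measure R).
Variables (F : scalars) (I : set R) (u : R -> \bar R) (q : R).
Hypotheses (mI : measurable I) (q0 : 0 < q) (wu : weight I u).
Local Notation Y := (wLspace F I u q).

Variable K : set Y.
Hypothesis cK : compact K.

(** Since [w c] is at most u, two functions close in L^q(u) are equally close for all the weights
    [w c] at once; smallness at h thus extends to a ball around h, and compactness makes it
    uniform. *)
Lemma compact_uniform_small (T : Type) (G : set_system T) (w : T -> R -> \bar R) :
  Filter G -> (forall c, weight I (w c)) ->
  (forall c x, I x -> (w c x <= u x)%E) ->
  (forall (h : Y) (e : R), 0 < e -> \forall c \near G, (wpow I q (w c) h <= e%:E)%E) ->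
  forall e : R, 0 < e -> \forall c \near G, forall h, K h -> (wpow I q (w c) h <= e%:E)%E.
Proof.
move=> FG ww wle wsmall e e0.
have /compact_near_coveringP cov := cK.
apply: (cov _ G (fun c (h : Y) => (wpow I q (w c) h <= e%:E)%E) FG).
move=> /= h0 Kh; pose h : Y := h0.
(* With both terms of [wpow_le_add] at most d, the sum is 2^q (d + d) = e. *)
pose d := e / (2 * 2 `^ q).
have KK0 : 0 < 2 * 2 `^ q :> R by rewrite mulr_gt0// powR_gt0.
have d0 : 0 < d by rewrite divr_gt0.
pose r := d `^ q^-1.
have r0 : 0 < r by rewrite powR_gt0.
have rq : r `^ q = d by rewrite -powRrM mulVf ?powRr1 ?gt_eqF// ltW.
exists (wLball h r, [set c | (wpow I q (w c) h <= d%:E)%E]).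
  by split => /=; [apply/nbhs_wLball => //; exists r|exact: wsmall].
move=> [k0 c] /= [hk kc]; pose k : Y := k0.
have {}hk : (wpow I q u (fun x => k x - h x)%R < d%:E)%E.
  by rewrite wpowB -rq; exact: (wLballE q0 wu h k (ltW r0)).1 hk.
have mh := cmeas_wL h; have mk := cmeas_wL k.
apply: le_trans (wpow_le_add mI q0 (ww c) mk mh) _.
have hk' : (wpow I q (w c) (fun x => k x - h x)%R <= d%:E)%E.
  apply: le_trans (ltW hk).
  exact: wpow_le_weight (ww c) wu (cmeasB mk mh) (wle c).
apply: (@le_trans _ _ ((2 `^ q)%:E * (d%:E + d%:E))%E).
  have P0 : (0 <= (2 `^ q)%:E :> \bar R)%E by rewrite lee_fin powR_ge0.
  exact: lee_wpmul2l P0 _ _ (leeD hk' kc).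
rewrite -EFinD -EFinM lee_fin /d le_eqVlt; apply/orP; left; apply/eqP.
by field; rewrite gt_eqF// powR_gt0.
Qed.

Lemma compact_bounded_wpow : exists2 M : R, 0 < M &
  forall h, K h -> (wpow I q u h <= M%:E)%E.
Proof.
have /compact_near_coveringP cov := cK.
have : \forall n \near \oo, K `<=` [set h : Y | (wpow I q u h <= n%:R%:E)%E].
  apply: (cov _ _ (fun (n : nat) (h : Y) => (wpow I q u h <= n%:R%:E)%E) _).
  move=> /= h0 Kh; pose h : Y := h0.
  have hfin : wpow I q u h \is a fin_num.
    by rewrite ge0_fin_numE; [exact: wpow_lty|exact: wpow_ge0].
  exists (wLball h 1, [set n : nat | 2 `^ q * (1 + fine (wpow I q u h)) < n%:R]).
    split => /=; first by apply/nbhs_wLball => //; exists 1.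
    exact: nbhs_infty_gtr.
  move=> [k0 n] /= [hk nn]; pose k : Y := k0.
  have {}hk : (wpow I q u (fun x => k x - h x)%R < 1)%E.
    by have := (wLballE q0 wu h k ler01).1 hk; rewrite powR1 wpowB.
  apply: le_trans (wpow_le_add mI q0 wu (cmeas_wL k) (cmeas_wL h)) _.
  apply: (@le_trans _ _ (2 `^ q * (1 + fine (wpow I q u h)))%:E); last by rewrite lee_fin ltW.
  rewrite EFinM EFinD fineK//; apply: lee_wpmul2l; first by rewrite lee_fin powR_ge0.
  by rewrite leeD2r// ltW.
(* The successor makes the bound strictly positive. *)
move=> [n _ /(_ n.+1 (leqnSn n)) H]; exists n.+1%:R => //.
Qed.

End uniform_tails.

Section cvg_ereal0.
Context {R : realType} (T : Type) (G : set_system T) (FG : Filter G).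

Lemma cvg_ereal0P (f : T -> \bar R) : (forall c, (0 <= f c)%E) ->
  (forall e : R, 0 < e -> \forall c \near G, (f c <= e%:E)%E) <-> f c @[c --> G] --> 0%E.
Proof.
move=> f0; split => [H|cf e e0]; last first.
  apply: (cf [set y | (y <= e%:E)%E]).
  have : nbhs (0%E : \bar R) [set y | (y < e%:E)%E].
    by apply: open_ereal_lt'; rewrite lte_fin.
  by apply: filterS => y /= /ltW.
apply/fine_cvgP; split.
  apply: filterS (H 1 ltr01) => c fc.
  by rewrite ge0_fin_numE// (le_lt_trans fc)// ltry.
apply/cvgrPdist_le => e e0; apply: filterS (H e e0) => c fc /=.
rewrite sub0r normrN ger0_norm ?fine_ge0// -lee_fin fineK//.
by rewrite ge0_fin_numE// (le_lt_trans fc)// ltry.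
Qed.

End cvg_ereal0.

Section D_properties.
Context {R : realType}.
Local Notation mu := (@lebesgue_measure R).
Variables (a b : \bar R) (v1 v2 : R -> \bar R) (p1' p2' q : R) (w : R -> \bar R).
Hypotheses (ab : (a < b)%E) (ww : weight (oint a b) w) (q0 : 0 < q).
Hypotheses (V1fin : forall x, oint a b x -> (wV a v1 p1' x < +oo)%E)
  (V2fin : forall x, oint a b x -> (wV a v2 p2' x < +oo)%E).
Local Notation V1 := (wVr a v1 p1').
Local Notation V2 := (wVr a v2 p2').
Local Notation I := (oint a b).
Local Notation c x := (V1 x `^ p1'^-1 * V2 x `^ p2'^-1).

Lemma D_ge0 : (0 <= D a b v1 v2 p1' p2' q w)%E.
Proof.
have [x Ix] := oint_neq0 ab; apply: le_trans (ereal_sup_ubound _); last by exists x.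
by rewrite !mule_ge0// poweR_ge0.
Qed.

Let W_ge0 x : I x -> (0 <= \int[mu]_(t in oint x%:E b) w t)%E.
Proof. by move=> Ix; apply: integral_ge0 => t /(sub_ointr Ix); exact: ww.2. Qed.

Let term x : I x -> ((\int[mu]_(t in oint x%:E b) w t) `^ q^-1
      * wV a v1 p1' x `^ p1'^-1 * wV a v2 p2' x `^ p2'^-1 =
   ((\int[mu]_(t in oint x%:E b) w t) * ((c x) `^ q)%:E) `^ q^-1)%E.
Proof.
move=> Ix; have c0 : 0 <= c x by rewrite mulr_ge0// powR_ge0.
rewrite poweRM//; [|exact: W_ge0|by rewrite lee_fin powR_ge0].
rewrite -(wVrE V1fin Ix) -(wVrE V2fin Ix) !poweR_EFin -muleA -EFinM; congr (_ * _%:E)%E.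
by rewrite -powRrM mulfV ?powRr1// gt_eqF.
Qed.

(** The q-th power of the condition, free of roots: the form that [bilinear_hardy] consumes and that
    the test functions produce. *)
Lemma D_le (e : R) : 0 <= e ->
  (forall x, I x -> ((\int[mu]_(t in oint x%:E b) w t) * ((c x) `^ q)%:E <= (e `^ q)%:E)%E) <->
  (D a b v1 v2 p1' p2' q w <= e%:E)%E.
Proof.
move=> e0.
have h0 x : I x -> (0 <= (\int[mu]_(t in oint x%:E b) w t) * ((c x) `^ q)%:E)%E.
  by move=> Ix; rewrite mule_ge0 ?W_ge0// lee_fin powR_ge0.
split=> [H|H x Ix].
  by apply: ge_ereal_sup => _ [x Ix <-]; rewrite term// poweR_inv_le ?h0 ?H.
rewrite -poweR_inv_le ?h0// -term//; apply: le_trans H.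
by apply: ereal_sup_ubound; exists x.
Qed.

End D_properties.

Section necessity.
Context {R : realType}.
Local Notation mu := (@lebesgue_measure R).
Variables (F : scalars) (a b : \bar R) (v1 v2 u : R -> \bar R) (p1 p2 p1' p2' q : R).
Hypotheses (ab : (a < b)%E)
  (mv1 : measurable_fun (oint a b) v1) (mv2 : measurable_fun (oint a b) v2)
  (v1pos : {ae mu, forall x, oint a b x -> (0 < v1 x < +oo)%E})
  (v2pos : {ae mu, forall x, oint a b x -> (0 < v2 x < +oo)%E})
  (wu : weight (oint a b) u)
  (pp1 : p1^-1 + p1'^-1 = 1) (pp2 : p2^-1 + p2'^-1 = 1)
  (V1fin : forall x, oint a b x -> (wV a v1 p1' x < +oo)%E)
  (V2fin : forall x, oint a b x -> (wV a v2 p2' x < +oo)%E)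
  (p1gt1 : 1 < p1) (p2gt1 : 1 < p2) (q0 : 0 < q).
Local Notation I := (oint a b).
Local Notation X1 := (wLspace F I v1 p1).
Local Notation X2 := (wLspace F I v2 p2).
Local Notation Y := (wLspace F I u q).
Local Notation V1 := (wVr a v1 p1').
Local Notation V2 := (wVr a v2 p2').

Lemma cmeas_hardy_wL (v : R -> \bar R) (p p' : R) (f : wLspace F I v p) :
  measurable_fun I v -> {ae mu, forall x, I x -> (0 < v x < +oo)%E} ->
  1 < p -> p^-1 + p'^-1 = 1 ->
  (forall x, I x -> (wV a v p' x < +oo)%E) -> cmeas I (hardy a f).
Proof.
move=> mv vpos p1_ pp Vfin.
have p0 : 0 < p by rewrite (lt_trans ltr01).
have mf := cmeas_wL f; have := wpow_lty p0 f.
case E : (wpow I p v f) => [M| |]// _.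
  by apply: (cmeas_hardy mv vpos p1_ pp Vfin mf (M := M)); rewrite E.
(* The value [-oo] is dispatched with the bound 0 rather than excluded, v being positive only almost
   everywhere. *)
by apply: (cmeas_hardy mv vpos p1_ pp Vfin mf (M := 0)); rewrite E leNye.
Qed.

Lemma cmeas_hardy2 (f : X1) (g : X2) : cmeas I (hardy2 a f g).
Proof.
apply: cmeasM; first exact: (cmeas_hardy_wL _ mv1 v1pos p1gt1 pp1 V1fin).
exact: (cmeas_hardy_wL _ mv2 v2pos p2gt1 pp2 V2fin).
Qed.

Variable T : X1 -> X2 -> Y.
Hypothesis Thardy : forall f g, wae_eq I u (T f g) (hardy2 a f g).

Definition ball_image : set Y := [set h | exists f g,
    [/\ wLclosed_unit_ball f, wLclosed_unit_ball g & h = T f g]].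

Let mI : measurable I. Proof. exact: measurable_oint. Qed.

(** T f g is known to be H_2(f, g) only off the zeros of u; the condition that w vanishes there too
    lets the two be exchanged under the weight w. *)
Lemma D_le_image (w : R -> \bar R) (e : R) : 0 <= e -> weight I w ->
  (forall x, I x -> u x = 0%E -> w x = 0%E) ->
  (forall h, ball_image h -> (wpow I q w h <= (e `^ q)%:E)%E) ->
  (D a b v1 v2 p1' p2' q w <= e%:E)%E.
Proof.
move=> e0 ww uw He; apply/D_le => // x Ix.
have [f [fB Hf]] := test_function F mv1 v1pos p1gt1 pp1 V1fin Ix.
have [g [gB Hg]] := test_function F mv2 v2pos p2gt1 pp2 V2fin Ix.
have := He (T f g); have -> : wpow I q w (T f g) = wpow I q w (hardy2 a f g).
  apply: wpow_ae => //; [exact: ww.1|exact: cmeas_wL|exact: cmeas_hardy2|].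
  have := Thardy f g; apply: ae_imply => t H [It /= wt]; apply: H; split => //=.
  by apply: contra wt => /eqP/uw ->.
have fgB : ball_image (T f g) by exists f, g.
move=> /(_ fgB) He'; apply: le_trans He'.
set c := _ * _.
have c0 : 0 <= c by rewrite mulr_ge0 ?powR_ge0.
have sub := sub_ointr Ix.
have mx : measurable (oint x%:E b) by exact: measurable_oint.
have mw : measurable_fun (oint x%:E b) w by exact: measurable_funS mI sub ww.1.
have w0 t : oint x%:E b t -> (0 <= w t)%E by move=> /sub; exact: ww.2.
have cq0 : 0 <= c `^ q by exact: powR_ge0.
rewrite [leLHS]muleC -(ge0_integralZl_EFin mu mx w0 mw cq0).
rewrite [leLHS](_ : _ = \int[mu]_(t in oint x%:E b)
    ((normc (hardy2 a f g t) `^ q)%:E * w t))%E.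
  apply: ge0_subset_integral => //.
  - exact: measurable_wpow ww.1 (cmeas_hardy2 f g).
  - by move=> t; exact: (integrand_ge0 q (hardy2 a f g) ww).
apply: eq_integral => t; rewrite inE => xt; have It := sub t xt.
case/andP : xt; rewrite lte_fin => /ltW xt _.
rewrite /hardy2 Hf// Hg// normc_sqrt/= !(mul0r, mulr0, subr0, addr0) expr0n/= addr0.
by rewrite sqrtr_sqr ger0_norm.
Qed.

Lemma hardy2_compact_necessary : compact (closure ball_image) ->
  [/\ (D a b v1 v2 p1' p2' q u < +oo)%E,
      Dminus a b v1 v2 p1' p2' q u c @[c --> decr_to a] --> 0%E
    & Dplus a b v1 v2 p1' p2' q u d @[d --> incr_to b] --> 0%E].
Proof.
move=> cA.
have sub : ball_image `<=` closure ball_image by exact: subset_closure.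
have mo x y : measurable (oint x y : set R) by exact: measurable_oint.
have wi x y : weight I (fun t => u t * (\1_(oint x y) t)%:E)%E.
  exact: weight_indic.
have iu x y t : I t -> (u t * (\1_(oint x y) t)%:E <= u t)%E.
  move=> It; rewrite indicE; case: (_ \in _); rewrite ?mule1 ?mule0//.
  exact: wu.2.
have fin (h : Y) : (wpow I q u h < +oo)%E by exact: wpow_lty.
(* Both ends are treated at once, the end points of the interval being functions of the
   parameter. *)
have tail (G : set_system R) (FG : Filter G) (x y : R -> \bar R) :
  (forall (h : Y) (e : R), 0 < e -> \forall c \near G,
     (wpow I q (fun t => u t * (\1_(oint (x c) (y c)) t)%:E) h <= e%:E)%E) ->
  D a b v1 v2 p1' p2' q (fun t => u t * (\1_(oint (x c) (y c)) t)%:E)%E @[c --> G]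
    --> 0%E.
  move=> small; apply/cvg_ereal0P; first by move=> c; exact: D_ge0.
  move=> e e0.
  have eq0 : 0 < e `^ q by rewrite powR_gt0.
  have H := compact_uniform_small mI q0 wu cA FG
    (fun c => wi (x c) (y c)) (fun c => iu (x c) (y c)) small eq0.
  apply: filterS H => c Hc; apply: D_le_image => //; first exact: ltW.
    by move=> t It ->; rewrite mul0e.
  by move=> h /sub; exact: Hc.
split.
- have [M M0 HM] := compact_bounded_wpow mI q0 wu cA.
  apply: (@le_lt_trans _ _ (M `^ q^-1)%:E); last exact: ltry.
  apply: D_le_image => //; first exact: powR_ge0.
  move=> h /sub/HM; rewrite -powRrM mulVf ?powRr1 ?gt_eqF//; exact: ltW.
- apply: (tail (decr_to a) _ (fun=> a) (fun c => c%:E)) => h e e0.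
  have := ge0_integral_oint_near_left ab
    (measurable_wpow q wu.1 (cmeas_wL h)) (fun x => integrand_ge0 q h wu) e0 (fin h).
  by apply: filterS => c; rewrite wpow_indic.
- apply: (tail (incr_to b) _ (fun d => d%:E) (fun=> b)) => h e e0.
  have := ge0_integral_oint_near_right ab
    (measurable_wpow q wu.1 (cmeas_wL h)) (fun x => integrand_ge0 q h wu) e0 (fin h).
  by apply: filterS => c; rewrite wpow_indic.
Qed.

End necessity.

(** * Sufficiency *)

Section equicontinuous_families.
Context {R : realType} {J : Type}.
Variables (S : set J) (O : set R).

Definition bdd_equicont (k : J -> R -> R) := forall x, O x ->
  (exists M, forall z, S z -> `|k z x| <= M) /\
  (forall e, 0 < e -> \forall y \near x, forall z, S z -> `|k z x - k z y| <= e).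

Lemma bdd_equicontN k : bdd_equicont k -> bdd_equicont (fun z x => - k z x).
Proof.
move=> Hk x Ox; have [[M kM] ke] := Hk x Ox; split.
  by exists M => z Sz; rewrite normrN kM.
move=> e e0; apply: filterS (ke e e0) => y ky z Sz.
by rewrite -opprD normrN ky.
Qed.

Lemma bdd_equicontD k l : bdd_equicont k -> bdd_equicont l ->
  bdd_equicont (fun z x => k z x + l z x).
Proof.
move=> Hk Hl x Ox; have [[M kM] ke] := Hk x Ox; have [[N lN] le] := Hl x Ox.
split.
  exists (M + N) => z Sz; apply: le_trans (ler_normD _ _) _.
  by rewrite lerD ?kM ?lN.
move=> e e0; have e2 : 0 < e / 2 by rewrite divr_gt0.
apply: filterS2 (ke _ e2) (le _ e2) => y ky ly z Sz.
rewrite opprD addrACA; apply: le_trans (ler_normD _ _) _; rewrite [leRHS]splitr.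
by rewrite lerD ?ky ?ly.
Qed.

Lemma bdd_equicontM k l : bdd_equicont k -> bdd_equicont l ->
  bdd_equicont (fun z x => k z x * l z x).
Proof.
move=> Hk Hl x Ox; have [[M0 kM0] ke] := Hk x Ox; have [[N0 lN0] le] := Hl x Ox.
(* The added 1 makes both bounds positive; in N it also absorbs the variation of l, so that |l z y|
   <= N for y near x. *)
pose M := `|M0| + 1; pose N := `|N0| + 1.
have M1 : 0 < M by rewrite ltr_wpDl.
have N1 : 0 < N by rewrite ltr_wpDl.
have kM z : S z -> `|k z x| <= M.
  by move=> /kM0 /le_trans; apply; rewrite (le_trans (ler_norm _))// lerDl.
have lN z : S z -> `|l z x| + 1 <= N.
  by move=> /lN0 H; rewrite lerD2r (le_trans H)// ler_norm.
split.
  exists (M * N) => z Sz; rewrite normrM ler_pM ?kM//.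
  by apply: le_trans (lN _ Sz); rewrite lerDl.
move=> e e0.
have e1 : 0 < e / 2 / M by rewrite !divr_gt0.
have e2 : 0 < e / 2 / N by rewrite !divr_gt0.
apply: filterS3 (ke _ e2) (le _ e1) (le _ ltr01) => y ky ly ly1 z Sz.
have -> : k z x * l z x - k z y * l z y =
  k z x * (l z x - l z y) + (k z x - k z y) * l z y by ring.
apply: le_trans (ler_normD _ _) _; rewrite [leRHS]splitr !normrM lerD//.
  rewrite -(@divfK _ M _ (e / 2)) ?gt_eqF// mulrC ler_pM ?ly ?kM//.
rewrite -(@divfK _ N _ (e / 2)) ?gt_eqF// ler_pM ?ky//.
apply: le_trans (lN _ Sz); rewrite -lerBlDl (le_trans _ (ly1 _ Sz))//.
rewrite distrC; exact: lerB_dist.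
Qed.

(* Along an ultrafilter every bounded family converges pointwise, so the
   Arzela-Ascoli theorem needs no extraction of subsequences. *)
Lemma ultra_ascoli (U : set_system J) (k : J -> R -> R) :
  UltraFilter U -> U S -> open O -> bdd_equicont k -> exists phi : R -> R,
  {in O, continuous phi} /\
  forall K, compact K -> K `<=` O -> forall e, 0 < e ->
    \forall z \near U, forall x, K x -> `|k z x - phi x| <= e.
Proof.
move=> UU US oO Hk.
have PU : ProperFilter U by exact: ultra_proper.
have cvgx x : O x -> exists l : R, k^~ x @ U --> l.
  move=> Ox; have [[M kM] _] := Hk x Ox.
  have cpt : compact `[- M, M]%classic by exact: segment_compact.
  have UM : U (k^~ x @^-1` `[- M, M]%classic).
    by apply: filterS US => z /kM kz; rewrite /= in_itv/= -ler_norml.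
  (* A cluster point of the image of an ultrafilter is its limit: otherwise the preimage of the
     complement of some neighbourhood would be in U. *)
  have [l [_ cl]] := cpt (k^~ x @ U) _ UM.
  exists l => V Vl; have [//|UV] := in_ultra_setVsetC (k^~ x @^-1` V) UU.
  by have [y [/= nVy Vy]] := cl (~` V) V UV Vl.
pose phi x : R := lim (k^~ x @ U).
have cvgphi x : O x -> k^~ x @ U --> phi x.
  by move=> /cvgx ?; apply/cvg_ex.
have near_phi x e : O x -> 0 < e -> \forall z \near U, `|k z x - phi x| <= e.
  by move=> /cvgphi /cvgrPdist_le H /H; apply: filterS => z; rewrite distrC.
have phi_dist x e : O x -> 0 < e -> \forall y \near x, `|phi x - phi y| <= e.
  move=> Ox e0; have e3 : 0 < e / 3 by rewrite divr_gt0.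
  have [_ ke] := Hk x Ox.
  have nO : nbhs x O by apply: open_nbhs_nbhs; split.
  apply: filterS2 nO (ke _ e3) => y Oy kxy.
  have [z [[zx zy] Sz]] := filter_ex
    (filterI (filterI (near_phi x _ Ox e3) (near_phi y _ Oy e3)) US).
  have := kxy z Sz => zxy.
  have -> : phi x - phi y = - (k z x - phi x) + ((k z x - k z y) + (k z y - phi y)) by ring.
  apply: le_trans (ler_normD _ _) _; rewrite normrN.
  have := ler_normD (k z x - k z y) (k z y - phi y); lra.
exists phi; split.
  move=> x; rewrite inE => Ox; apply/cvgrPdist_le => e; exact: phi_dist.
move=> K cK KO e e0; have e3 : 0 < e / 3 by rewrite divr_gt0.
have /compact_near_coveringP cov := cK.
apply: (cov _ U (fun z x => `|k z x - phi x| <= e) _) => x /KO Ox.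
have [_ ke] := Hk x Ox.
(* The error at y is compared with the error at x through the variation of phi and that of k z, each
   worth e/3. *)
exists ([set y | (forall z, S z -> `|k z x - k z y| <= e / 3) /\ `|phi x - phi y| <= e / 3],
  [set z | S z /\ `|k z x - phi x| <= e / 3]).
  by split; apply: filterI => //=; [exact: ke|exact: phi_dist|exact: near_phi].
move=> [y z] /= [[kxy pxy] [Sz zx]]; have := kxy z Sz => zxy.
have -> : k z y - phi y = (phi x - phi y) + (- (k z x - k z y) + (k z x - phi x)) by ring.
apply: le_trans (ler_normD _ _) _.
have := ler_normD (- (k z x - k z y)) (k z x - phi x); rewrite normrN; lra.
Qed.

End equicontinuous_families.

Section sufficiency.
Context {R : realType}.
Local Notation mu := (@lebesgue_measure R).
Variables (F : scalars) (a b : \bar R) (v1 v2 u : R -> \bar R) (p1 p2 p1' p2' q : R).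
Hypotheses (ab : (a < b)%E)
  (mv1 : measurable_fun (oint a b) v1) (mv2 : measurable_fun (oint a b) v2)
  (v1pos : {ae mu, forall x, oint a b x -> (0 < v1 x < +oo)%E})
  (v2pos : {ae mu, forall x, oint a b x -> (0 < v2 x < +oo)%E})
  (wu : weight (oint a b) u)
  (pp1 : p1^-1 + p1'^-1 = 1) (pp2 : p2^-1 + p2'^-1 = 1)
  (V1fin : forall x, oint a b x -> (wV a v1 p1' x < +oo)%E)
  (V2fin : forall x, oint a b x -> (wV a v2 p2' x < +oo)%E)
  (p1gt1 : 1 < p1) (p2gt1 : 1 < p2) (p1q : p1 <= q) (p2q : p2 <= q).
Local Notation I := (oint a b).
Local Notation X1 := (wLspace F I v1 p1).
Local Notation X2 := (wLspace F I v2 p2).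
Local Notation Y := (wLspace F I u q).
Local Notation V1 := (wVr a v1 p1').
Local Notation V2 := (wVr a v2 p2').

Let mI : measurable I. Proof. exact: measurable_oint. Qed.
Let p10 : 0 < p1. Proof. exact: lt_trans p1gt1. Qed.
Let p20 : 0 < p2. Proof. exact: lt_trans p2gt1. Qed.
Let q0 : 0 < q. Proof. exact: lt_le_trans p1q. Qed.

(** 4 = 2 * 2 comes from [normc_hardy_le] applied to f and to g, the other factors from the two
    linear inequalities. *)
Definition hardy2_cst (M1 M2 : R) := 4 `^ q * (hardy_cst p2 q M2 * hardy_cst p1 q M1).

(** With w = u this gives values in L^q(u), for f and g of any norm; with u restricted to an end of
    I and M1 = M2 = 1 it gives uniformly small tails. *)
Lemma wpow_hardy2_le (w : R -> \bar R) (e M1 M2 : R) (f g : R -> R[i]) :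
  0 <= e -> weight I w -> (D a b v1 v2 p1' p2' q w <= e%:E)%E ->
  cmeas I f -> (wpow I p1 v1 f <= M1%:E)%E ->
  cmeas I g -> (wpow I p2 v2 g <= M2%:E)%E ->
  (wpow I q w (hardy2 a f g) <= (hardy2_cst M1 M2 * e `^ q)%:E)%E.
Proof.
move=> e0 ww /(D_le ww q0 V1fin V2fin e0).2 De mf fM mg gM.
have [p10' _ _] := conj_exponent p1gt1 pp1.
have [p20' _ _] := conj_exponent p2gt1 pp2.
have B1 := hoelder_bound_normc mv1 v1pos p1gt1 pp1 V1fin mf fM.
have B2 := hoelder_bound_normc mv2 v2pos p2gt1 pp2 V2fin mg gM.
have mF1 := measurable_prim_normc mv1 v1pos p1gt1 pp1 V1fin mf fM.
have mF2 := measurable_prim_normc mv2 v2pos p2gt1 pp2 V2fin mg gM.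
set F1 := prim a (fun t => normc (f t)) in mF1.
set F2 := prim a (fun t => normc (g t)) in mF2.
have F10 x : I x -> 0 <= F1 x by exact: prim_normc_ge0.
have F20 x : I x -> 0 <= F2 x by exact: prim_normc_ge0.
have De' x : I x -> ((\int[mu]_(t in oint x%:E b) w t) *
     (V1 x `^ (q / p1') * V2 x `^ (q / p2'))%:E <= (e `^ q)%:E)%E.
  move=> Ix; have := De x Ix.
  by rewrite powRM ?powR_ge0// -!powRrM [p1'^-1 * q]mulrC [p2'^-1 * q]mulrC.
have H := bilinear_hardy ab B1 B2 (wVr_le mv1 V1fin) (wVr_le mv2 V2fin)
  p10 p20 p10' p20' p1q p2q ww.1 ww.2 De'.
apply: (@le_trans _ _ (\int[mu]_(x in I) (((4 * (F1 x * F2 x)) `^ q)%:E * w x))%E).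
  apply: wpow_le => //.
  - apply: cmeasM; first exact: (cmeas_hardy mv1 v1pos p1gt1 pp1 V1fin mf fM).
    exact: (cmeas_hardy mv2 v2pos p2gt1 pp2 V2fin mg gM).
  - by apply: measurable_funM => //; exact: measurable_funM.
  - move=> x Ix; rewrite /hardy2 Normc.normcM.
    apply: (@le_trans _ _ ((2 * F1 x) * (2 * F2 x))).
      apply: ler_pM; rewrite ?normc_ge0//.
        exact: (normc_hardy_le mv1 v1pos p1gt1 pp1 V1fin mf fM).
      exact: (normc_hardy_le mv2 v2pos p2gt1 pp2 V2fin mg gM).
    by rewrite mulrACA -natrM.
rewrite [leLHS](_ : _ = (4 `^ q)%:E *
    \int[mu]_(x in I) (((F1 x * F2 x) `^ q)%:E * w x))%E.
  have -> : hardy2_cst M1 M2 * e `^ q =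
      4 `^ q * (hardy_cst p2 q M2 * (hardy_cst p1 q M1 * e `^ q)).
    by rewrite /hardy2_cst; ring.
  rewrite EFinM; apply: lee_wpmul2l; first by rewrite lee_fin powR_ge0.
  exact: H.
rewrite -ge0_integralZl_EFin ?powR_ge0//.
- apply: eq_integral => x; rewrite inE => Ix.
  by rewrite muleA -EFinM -powRM// mulr_ge0 ?F10 ?F20.
- by move=> x Ix; rewrite mule_ge0 ?lee_fin ?powR_ge0// ww.2.
- apply: emeasurable_funM; last exact: ww.1.
  apply/measurable_EFinP; apply: (measurableT_comp (measurable_powR q)).
  exact: measurable_funM.
Qed.

Lemma wpow_le1 (v : R -> \bar R) (p : R) (f : wLspace F I v p) : 0 < p ->
  wLclosed_unit_ball f -> (wpow I p v f <= 1%:E)%E.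
Proof.
move=> p0; rewrite /wLclosed_unit_ball/= /wLnorm -/(wpow I p v f).
have [x0|/ltW x0] := leP 0%E (wpow I p v f).
  by rewrite poweR_inv_le// powR1.
by move=> _; apply: le_trans x0 _; rewrite lee_fin.
Qed.

Lemma bdd_equicont_hardy (v : R -> \bar R) (p p' : R) (J : Type) (S : set J)
  (s : J -> wLspace F I v p) :
  measurable_fun I v -> {ae mu, forall x, I x -> (0 < v x < +oo)%E} ->
  1 < p -> p^-1 + p'^-1 = 1 ->
  (forall x, I x -> (wV a v p' x < +oo)%E) ->
  (forall z, S z -> wLclosed_unit_ball (s z)) ->
  bdd_equicont S I (fun z x => complex.Re (hardy a (s z) x)) /\
  bdd_equicont S I (fun z x => complex.Im (hardy a (s z) x)).
Proof.
move=> mv vpos p_1 pp Vfin sB.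
have p0 : 0 < p by rewrite (lt_trans ltr01).
have [p'0 _ _] := conj_exponent p_1 pp.
have M1 z : S z -> (wpow I p v (s z) <= 1%:E)%E by move=> /sB; exact: wpow_le1.
have bd z x : S z -> I x -> normc (hardy a (s z) x) <= 2 * wVr a v p' x `^ p'^-1.
  move=> Sz Ix.
  apply: le_trans (normc_hardy_le mv vpos p_1 pp Vfin (cmeas_wL _) (M1 z Sz) Ix) _.
  rewrite ler_pM2l// (le_trans (prim_normc_le mv vpos p_1 pp Vfin (cmeas_wL _) (M1 z Sz) Ix))//.
  by rewrite powR1 mul1r.
have ms : measurable_fun I (fun t => v t `^ (1 - p'))%E.
  exact: (measurableT_comp (measurable_poweR _)).
have eqc x e : I x -> 0 < e -> \forall y \near x, forall z, S z ->
   `|complex.Re (hardy a (s z) x) - complex.Re (hardy a (s z) y)| <= e /\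
   `|complex.Im (hardy a (s z) x) - complex.Im (hardy a (s z) y)| <= e.
  move=> Ix e0; have ep : 0 < e `^ p' by rewrite powR_gt0.
  have := integral_oint_small ms (fun x _ => poweR_ge0 _ _) Vfin Ix ep.
  apply: filterS => y [Iy sy] z Sz.
  have := hardy_dist_le mv vpos p_1 pp Vfin (cmeas_wL _) (M1 z Sz) Ix Iy (ltW ep) sy.
  by rewrite powR1 mul1r -powRrM mulfV ?powRr1 ?gt_eqF// ltW.
split=> x Ix; split.
- exists (2 * wVr a v p' x `^ p'^-1) => z Sz.
  exact: le_trans (Re_le_normc _) (bd z x Sz Ix).
- by move=> e e0; apply: filterS (eqc x e Ix e0) => y H z /H[].
- exists (2 * wVr a v p' x `^ p'^-1) => z Sz.
  exact: le_trans (Im_le_normc _) (bd z x Sz Ix).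
- by move=> e e0; apply: filterS (eqc x e Ix e0) => y H z /H[].
Qed.

Lemma is_wLfun_hardy2 (f : X1) (g : X2) : (D a b v1 v2 p1' p2' q u < +oo)%E ->
  is_wLfun F I u q (hardy2 a f g).
Proof.
move=> Dfin; have D0 : (0 <= D a b v1 v2 p1' p2' q u)%E by exact: D_ge0.
have DE : (D a b v1 v2 p1' p2' q u <= (fine (D a b v1 v2 p1' p2' q u))%:E)%E.
  by rewrite fineK// ge0_fin_numE.
have [m1 m2] := cmeas_hardy2 mv1 mv2 v1pos v2pos pp1 pp2 V1fin V2fin p1gt1 p2gt1 f g.
have fin (x : \bar R) : (x < +oo)%E -> exists M, (x <= M%:E)%E.
  case: x => [r| |]// _; first by exists r.
  by exists 0; rewrite leNye.
have [M1 fM] := fin _ (wpow_lty p10 f); have [M2 gM] := fin _ (wpow_lty p20 g).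
split => //.
  (* Over the complex scalars nothing is left; over the reals, the imaginary parts of both Hardy
     transforms are integrals of 0. *)
  move=> x Ix; case: F f g fM gM m1 m2 => // f g _ _ _ _.
  have f0 y : I y -> complex.Im (f y) = 0.
    by rewrite /wLspace_to_fun; case: (repr f) => h [_ _ H _] /=; exact: H.
  have g0 y : I y -> complex.Im (g y) = 0.
    by rewrite /wLspace_to_fun; case: (repr g) => h [_ _ H _] /=; exact: H.
  have R0 (h : R -> R) : (forall y, I y -> h y = 0) ->
     \int[mu]_(t in oint a x%:E) h t = 0.
    move=> h0; rewrite /Rintegral integral0_eq// => t /(sub_ointl Ix)/h0 /= ->//.
  by rewrite /= (R0 _ f0) (R0 _ g0) mulr0 mul0r addr0.
rewrite /wLnorm -/(wpow I q u (hardy2 a f g)); apply: poweR_lty.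
apply: le_lt_trans (wpow_hardy2_le (fine_ge0 D0) wu DE (cmeas_wL f) fM (cmeas_wL g) gM) _.
exact: ltry.
Qed.

End sufficiency.

(** * Limits of ultrafilters in L^q(u) *)

Section ultra_limit.
Context {R : realType}.
Local Notation mu := (@lebesgue_measure R).
Variables (F : scalars) (a b : \bar R) (u : R -> \bar R) (q : R).
Hypotheses (ab : (a < b)%E) (wu : weight (oint a b) u) (q0 : 0 < q)
  (uloc : forall K : set R, compact K -> K `<=` oint a b -> mu.-integrable K u).
Local Notation I := (oint a b).
Local Notation Y := (wLspace F I u q).
Variables (A : set Y) (U : set_system Y) (k : Y -> R -> R[i]).
Hypotheses (UU : UltraFilter U) (UA : U A)
  (mk : forall z, cmeas I (k z)) (zk : forall z, A z -> wae_eq I u z (k z))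
  (ek1 : bdd_equicont A I (fun z x => complex.Re (k z x)))
  (ek2 : bdd_equicont A I (fun z x => complex.Im (k z x)))
  (sk : forall z x, A z -> I x -> is_scalar F (k z x)).
Hypothesis kM : exists2 M : R, 0 < M & forall z, A z -> (wpow I q u (k z) <= M%:E)%E.
Hypothesis ktail : forall e : R, 0 < e -> exists c d,
  [/\ (a < c%:E)%E, (d%:E < b)%E,
   forall z, A z -> (wpow I q (fun x => u x * (\1_(oint a c%:E) x)%:E) (k z) <= e%:E)%E
 & forall z, A z -> (wpow I q (fun x => u x * (\1_(oint d%:E b) x)%:E) (k z) <= e%:E)%E].

Let mI : measurable I. Proof. exact: measurable_oint. Qed.
Let FU : ProperFilter U. Proof. exact: ultra_proper. Qed.
Let u0 x : I x -> (0 <= u x)%E. Proof. exact: wu.2. Qed.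

Let uK c d := (fun x => u x * (\1_(`[c, d]%classic) x)%:E)%E.

Let wuK c d : weight I (uK c d).
Proof. by apply: weight_indic => //; exact: measurable_itv. Qed.

Let locally_uniform_wpow (psi : R -> R[i]) (c d : R) : cmeas I psi ->
  (a < c%:E)%E -> (d%:E < b)%E ->
  (forall e, 0 < e -> \forall z \near U, forall x, `[c, d]%classic x ->
     normc (psi x - k z x) <= e) ->
  forall e : R, 0 < e -> \forall z \near U,
    (wpow I q (uK c d) (fun x => psi x - k z x)%R <= e%:E)%E.
Proof.
move=> mpsi ac db H e e0.
have sub := sub_itv_oint ac db.
have ucd := uloc (@segment_compact _ c d) sub.
have mcd : measurable (`[c, d]%classic : set R) by exact: measurable_itv.
pose L := (\int[mu]_(x in `[c, d]) u x)%E.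
have L0 : (0 <= L)%E by apply: integral_ge0 => x /sub/u0.
have Lfin : L \is a fin_num by exact: integrable_fin_num.
pose l := fine L; have l0 : 0 <= l by exact: fine_ge0.
(* The tolerance d1^(1/q) turns into d1 under the power q, and d1 l <= e; the added 1 covers l =
   0. *)
pose d1 := e / (l + 1).
have l1 : 0 < l + 1 by rewrite ltr_wpDl.
have d10 : 0 < d1 by rewrite divr_gt0.
have r0 : 0 < d1 `^ q^-1 by rewrite powR_gt0.
apply: filterS (H _ r0) => z Hz; rewrite wpow_indic setIidr//.
apply: (@le_trans _ _ (\int[mu]_(x in `[c, d]) (d1%:E * u x))%E).
  apply: ge0_le_integral => //.
  - by move=> x /sub Ix; rewrite mule_ge0 ?u0// lee_fin powR_ge0.
  - by apply: measurable_funS mI sub _; exact: measurable_wpow wu.1 (cmeasB mpsi (mk z)).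
  - by apply: measurable_funeM; exact: measurable_funS mI sub wu.1.
  - move=> x cdx; apply: lee_wpmul2r; first exact/u0/sub.
    have := ge0_ler_powR (ltW q0) _ _ (Hz x cdx).
    rewrite !nnegrE normc_ge0 powR_ge0 => /(_ isT isT).
    by rewrite -powRrM mulVf ?powRr1 ?gt_eqF// ltW.
rewrite ge0_integralZl_EFin ?(ltW d10)//; last 2 first.
- by move=> x /sub/u0.
- exact: measurable_funS mI sub wu.1.
rewrite -/L -(fineK Lfin) -EFinM lee_fin -/l /d1 mulrAC ler_pdivrMr//.
by rewrite ler_pM2l// lerDl.
Qed.

Let wul c : weight I (fun x => u x * (\1_(oint a c%:E) x)%:E)%E.
Proof. by apply: weight_indic => //; exact: measurable_oint. Qed.

Let wur d : weight I (fun x => u x * (\1_(oint d%:E b) x)%:E)%E.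
Proof. by apply: weight_indic => //; exact: measurable_oint. Qed.

Let indic_le (D : set R) x : I x -> (u x * (\1_D x)%:E <= u x)%E.
Proof.
by move=> Ix; rewrite indicE; case: (_ \in _); rewrite ?mule1 ?mule0 ?u0.
Qed.

(** Every point of I lies in (a, c), [c, d] or (d, b). When d < c the end pieces overlap, hence an
    inequality. *)
Let wpow_split c d (g : R -> R[i]) : cmeas I g ->
  (wpow I q u g <= wpow I q (fun x => u x * (\1_(oint a c%:E) x)%:E)%E g +
     (wpow I q (uK c d) g + wpow I q (fun x => u x * (\1_(oint d%:E b) x)%:E)%E g))%E.
Proof.
move=> mg; rewrite /wpow -ge0_integralD//; last 4 first.
- by move=> x; exact: (integrand_ge0 q g (wuK c d)).
- exact: measurable_wpow (wuK c d).1 mg.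
- by move=> x; exact: (integrand_ge0 q g (wur d)).
- exact: measurable_wpow (wur d).1 mg.
have Kr0 x : I x -> (0 <= (normc (g x) `^ q)%:E * uK c d x +
    (normc (g x) `^ q)%:E * (u x * (\1_(oint d%:E b) x)%:E))%E.
  move=> Ix; apply: adde_ge0; first exact: (integrand_ge0 q g (wuK c d)).
  exact: (integrand_ge0 q g (wur d)).
have mKr : measurable_fun I (fun x => (normc (g x) `^ q)%:E * uK c d x +
    (normc (g x) `^ q)%:E * (u x * (\1_(oint d%:E b) x)%:E))%E.
  apply: emeasurable_funD; first exact: measurable_wpow (wuK c d).1 mg.
  exact: measurable_wpow (wur d).1 mg.
rewrite -ge0_integralD//; last 2 first.
- by move=> x; exact: (integrand_ge0 q g (wul c)).
- exact: measurable_wpow (wul c).1 mg.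
have l0 x : I x -> (0 <= (normc (g x) `^ q)%:E * (u x * (\1_(oint a c%:E) x)%:E))%E.
  exact: (integrand_ge0 q g (wul c)).
apply: ge0_le_integral => //.
- by move=> x; exact: (integrand_ge0 q g wu).
- exact: measurable_wpow wu.1 mg.
- by apply: emeasurable_funD => //; exact: measurable_wpow (wul c).1 mg.
move=> x Ix; have /andP[ax xb] := Ix.
have [xc|cx] := ltP x c.
  rewrite -[leLHS]adde0; apply: leeD; last exact: Kr0.
  by rewrite indicE mem_set ?mule1// /oint/= ax lte_fin.
rewrite -[leLHS]add0e; apply: leeD; first exact: l0.
have [xd|dx] := leP x d.
  rewrite -[leLHS]adde0; apply: leeD; last exact: (integrand_ge0 q g (wur d)).
  by rewrite /uK indicE mem_set ?mule1//= in_itv/= cx.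
rewrite -[leLHS]add0e; apply: leeD; first exact: (integrand_ge0 q g (wuK c d)).
by rewrite indicE mem_set ?mule1// /oint/= xb andbT lte_fin.
Qed.

Lemma ultra_limit : exists h : Y, U --> h.
Proof.
have oI : open I by exact: open_oint.
have [phi1 [cphi1 Uphi1]] := ultra_ascoli UU UA oI ek1.
have [phi2 [cphi2 Uphi2]] := ultra_ascoli UU UA oI ek2.
pose psi x : R[i] := Complex (phi1 x) (phi2 x).
have mpsi : cmeas I psi by split; exact: open_continuous_measurable_fun.
have unif c d : (a < c%:E)%E -> (d%:E < b)%E -> forall e, 0 < e ->
    \forall z \near U, forall x, `[c, d]%classic x -> normc (psi x - k z x) <= e.
  move=> ac db e e0; have e2 : 0 < e / 2 by rewrite divr_gt0.
  have sub := sub_itv_oint ac db; have cpt := @segment_compact _ c d.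
  apply: filterS2 (Uphi1 _ cpt sub _ e2) (Uphi2 _ cpt sub _ e2) => z H1 H2 x cdx.
  rewrite normcB; apply: le_trans (normc_le _) _; rewrite [leRHS]splitr.
  by have := H1 x cdx; have := H2 x cdx; rewrite /psi; case: (k z x) => r i /= ? ?; rewrite lerD.
have small c d ac db := locally_uniform_wpow mpsi ac db (unif c d ac db).
(* On each segment psi is compared with a single k z: one B is the error of approximation, the other
   bounds k z. The result does not depend on the segment. It serves for w = u and for both tails. *)
have bound w (B : R) : 0 < B -> weight I w -> (forall x, I x -> (w x <= u x)%E) ->
    (forall z, A z -> (wpow I q w (k z) <= B%:E)%E) ->
    (wpow I q w psi <= (2 `^ q * (B + B))%:E)%E.
  move=> B0 ww wleu kB.
  apply: ge0_integral_oint_le => //.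
  - exact: measurable_wpow ww.1 mpsi.
  - by move=> x; exact: (integrand_ge0 q psi ww).
  move=> c d ac db.
  have sub := sub_itv_oint ac db.
  have wwK : weight I (fun x => w x * (\1_(`[c, d]%classic) x)%:E)%E.
    by apply: weight_indic => //; exact: measurable_itv.
  have [z [Az Hz]] := filter_ex (filterI UA (small c d ac db _ B0)).
  have := wpow_le_add mI q0 wwK mpsi (mk z).
  rewrite {1}wpow_indic setIidr// => /le_trans; apply.
  rewrite EFinM; apply: lee_wpmul2l; first by rewrite lee_fin powR_ge0.
  rewrite EFinD; apply: leeD.
    apply: le_trans Hz; apply: wpow_le_weight => //; first exact: cmeasB.
    by move=> x Ix; apply: lee_wpmul2r; [rewrite lee_fin|exact: wleu].
  apply: le_trans (kB z Az); apply: wpow_le_weight => //.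
  move=> x Ix; rewrite indicE; case: (_ \in _); rewrite ?mule1 ?mule0//.
  exact: ww.2.
have psiY : is_wLfun F I u q psi.
  split; [exact: mpsi.1|exact: mpsi.2| |].
    move=> x Ix; rewrite /is_scalar; case E : F => //=.
    apply/eqP/negPn/negP => px.
    (* A nonzero imaginary part at x would be approximated by 0 within half of its modulus. *)
    have e0 : 0 < `|phi2 x| / 2 by rewrite divr_gt0// normr_gt0.
    have sub1 : `[x, x]%classic `<=` I by rewrite set_itv1 => y ->.
    have [z [Az Hz]] := filter_ex
      (filterI UA (Uphi2 _ (@segment_compact _ x x) sub1 _ e0)).
    have := sk Az Ix; rewrite E /= => k0.
    have := Hz x; rewrite /= in_itv/= lexx k0 sub0r normrN => /(_ isT).
    have := e0; lra.
  have [M M0 HM] := kM.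
  rewrite /wLnorm -/(wpow I q u psi); apply: poweR_lty.
  apply: le_lt_trans (bound u M M0 wu (fun x _ => lexx _) HM) _.
  exact: ltry.
pose h : Y := (\pi_Y (WLfun psiY))%qT.
have hpsi : wae_eq I u h psi by exact: pi_wae psiY.
exists h => V /(nbhs_wLball mI q0 wu)[e e0 eV].
set P : R := 2 `^ q; have P0 : 0 < P by rewrite powR_gt0.
set t := e `^ q; have t0 : 0 < t by rewrite powR_gt0.
(* eta solves P (P (eta + eta) + eta) = t/4, where P (eta + eta) bounds the tail of psi and eta that
   of k z. Two tails and the middle then add up to 3t/4 < t. *)
pose eta := t / (4 * (P * (P * 2 + 1))).
have Q0 : 0 < P * (P * 2 + 1) by rewrite mulr_gt0// addr_gt0// mulr_gt0.
have eta0 : 0 < eta by rewrite divr_gt0// mulr_gt0.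
have etaE : P * (P * (eta + eta) + eta) = t / 4.
  rewrite /eta; field.
  by rewrite (gt_eqF P0)/= gt_eqF// addr_gt0// mulr_gt0.
have [c [d [ac db kl kr]]] := ktail eta0.
have tail w : weight I w -> (forall x, I x -> (w x <= u x)%E) ->
    (forall z, A z -> (wpow I q w (k z) <= eta%:E)%E) ->
    forall z, A z -> (wpow I q w (fun x => psi x - k z x)%R <= (t / 4)%:E)%E.
  move=> ww wle wk z Az.
  apply: le_trans (wpow_sub_le mI q0 ww mpsi (mk z)) _.
  rewrite -etaE -/P [leRHS]EFinM; apply: lee_wpmul2l; first by rewrite lee_fin ltW.
  by rewrite EFinD; apply: leeD; [exact: bound|exact: wk].
have t40 : 0 < t / 4 by rewrite divr_gt0.
apply: filterS2 UA (small c d ac db _ t40) => z Az Hz; apply: eV.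
apply: (wLballE q0 wu h z (ltW e0)).2.
have -> : wpow I q u (fun x => h x - z x)%R = wpow I q u (fun x => psi x - k z x)%R.
  apply: wpow_ae => //; [exact: wu.1| | |exact: wae_eqB (zk Az)].
    by apply: cmeasB; exact: cmeas_wL.
  exact: cmeasB.
apply: le_lt_trans (wpow_split c d (cmeasB mpsi (mk z))) _.
apply: (@le_lt_trans _ _ ((t / 4)%:E + ((t / 4)%:E + (t / 4)%:E))%E).
  apply: leeD; first exact: tail (wul c) (fun x => @indic_le _ x) kl z Az.
  by apply: leeD => //; exact: tail (wur d) (fun x => @indic_le _ x) kr z Az.
rewrite -!EFinD lte_fin -/t; lra.
Qed.

End ultra_limit.

(** * Assembly of the two directions *)

Unset Implicit Arguments.

Theorem corollary7p2 (R : realType) (F : scalars) (a b : \bar R)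
    (v1 v2 u : R -> \bar R) (p1 p2 p1' p2' q : R)
    (hab : (a < b)%E)
    (hv1 : measurable_fun (oint a b) v1)
    (hv2 : measurable_fun (oint a b) v2)
    (hv1pos : {ae (@lebesgue_measure R),
      forall x, oint a b x -> (0 < v1 x < +oo)%E})
    (hv2pos : {ae (@lebesgue_measure R),
      forall x, oint a b x -> (0 < v2 x < +oo)%E})
    (hu : measurable_fun (oint a b) u)
    (hu0 : forall x, oint a b x -> (0 <= u x)%E)
    (huloc : forall K : set R, compact K -> K `<=` oint a b ->
      (@lebesgue_measure R).-integrable K u)
    (hp1' : p1^-1 + p1'^-1 = 1)
    (hp2' : p2^-1 + p2'^-1 = 1)
    (hV1 : forall x, oint a b x -> (wV a v1 p1' x < +oo)%E)
    (hV2 : forall x, oint a b x -> (wV a v2 p2' x < +oo)%E)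
    (hp1 : 1 < p1) (hp2 : 1 < p2) (hq : Num.max p1 p2 <= q) :
  hardy2_compact F a b v1 v2 u p1 p2 q <->
  [/\ (D a b v1 v2 p1' p2' q u < +oo)%E,
      Dminus a b v1 v2 p1' p2' q u c @[c --> decr_to a] --> 0%E
    & Dplus a b v1 v2 p1' p2' q u d @[d --> incr_to b] --> 0%E].
Proof.
have [p1q p2q] : p1 <= q /\ p2 <= q by move: hq; rewrite ge_max => /andP[].
have q0 : 0 < q by rewrite (lt_le_trans _ p1q)// (lt_trans ltr01).
have wu : weight (oint a b) u by [].
split=> [[T [HT cT]]|[Dfin Dm Dp]].
  exact: (hardy2_compact_necessary hab hv1 hv2 hv1pos hv2pos wu hp1' hp2'
    hV1 hV2 hp1 hp2 q0 HT cT).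
have mI : measurable (oint a b : set R) by exact: measurable_oint.
have Tfun (f : wLspace F (oint a b) v1 p1) (g : wLspace F (oint a b) v2 p2) :=
  is_wLfun_hardy2 hab hv1 hv2 hv1pos hv2pos wu hp1' hp2' hV1 hV2 hp1 hp2 p1q p2q
    f g Dfin.
pose T f g : wLspace F (oint a b) u q :=
  (\pi_(wLspace F (oint a b) u q) (WLfun (Tfun f g)))%qT.
have HT f g : wae_eq (oint a b) u (T f g) (hardy2 a f g) by exact: pi_wae (Tfun f g).
exists T; split=> //; apply: compact_closure_ultra => // U UU UA.
have FU : ProperFilter U by exact: ultra_proper.
set A := [set _ | _] in UA.
have [_ [f0 [g0 _]]] := filter_ex UA.
(* Every z of the image is given a pair that produces it; outside the image a pair taken from a
   point of A is the default value. *)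
have /choice[s Hs] : forall z : wLspace F (oint a b) u q,
    exists fg : wLspace F (oint a b) v1 p1 * wLspace F (oint a b) v2 p2,
    A z -> [/\ wLclosed_unit_ball fg.1, wLclosed_unit_ball fg.2 & z = T fg.1 fg.2].
  move=> z; have [[f [g fgz]]|nAz] := pselect (A z); last by exists (f0, g0).
  by exists (f, g).
have s1 z : A z -> wLclosed_unit_ball (s z).1 by move=> /Hs[].
have s2 z : A z -> wLclosed_unit_ball (s z).2 by move=> /Hs[].
have [er1 ei1] := bdd_equicont_hardy (s := fun z => (s z).1) hv1 hv1pos hp1 hp1' hV1 s1.
have [er2 ei2] := bdd_equicont_hardy (s := fun z => (s z).2) hv2 hv2pos hp2 hp2' hV2 s2.
pose C := hardy2_cst p1 p2 q 1 1.
have C0 : 0 <= C by rewrite mulr_ge0 ?powR_ge0// mulr_ge0// hardy_cst_ge0.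
have p10 : 0 < p1 by rewrite (lt_trans ltr01).
have p20 : 0 < p2 by rewrite (lt_trans ltr01).
have bound w e z : 0 <= e -> weight (oint a b) w ->
    (D a b v1 v2 p1' p2' q w <= e%:E)%E -> A z ->
    (wpow (oint a b) q w (hardy2 a (s z).1 (s z).2) <= (C * e `^ q)%:E)%E.
  move=> e0 ww De Az.
  apply: (wpow_hardy2_le hab hv1 hv2 hv1pos hv2pos hp1' hp2' hV1 hV2 hp1 hp2
    p1q p2q e0 ww De (cmeas_wL _) _ (cmeas_wL _) _).
    exact: wpow_le1 p10 (s1 z Az).
  exact: wpow_le1 p20 (s2 z Az).
apply: (@ultra_limit _ F a b u q hab wu q0 huloc A U
  (fun z => hardy2 a (s z).1 (s z).2)) => //.
- by move=> z; exact: (cmeas_hardy2 hv1 hv2 hv1pos hv2pos hp1' hp2' hV1 hV2 hp1 hp2).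
- by move=> z /Hs[_ _ {1}->]; exact: HT.
(* By conversion, the real part of the product is Re Re - Im Im, and the imaginary part in the next
   goal is Re Im + Im Re. *)
- exact: bdd_equicontD (bdd_equicontM er1 er2) (bdd_equicontN (bdd_equicontM ei1 ei2)).
- exact: bdd_equicontD (bdd_equicontM er1 ei2) (bdd_equicontM ei1 er2).
- by move=> z x _ Ix; have [_ _ + _] := Tfun (s z).1 (s z).2; exact.
- have D0 := D_ge0 v1 v2 p1' p2' q u hab.
  have DE : (D a b v1 v2 p1' p2' q u <= (fine (D a b v1 v2 p1' p2' q u))%:E)%E.
    by rewrite fineK// ge0_fin_numE.
  exists (C * fine (D a b v1 v2 p1' p2' q u) `^ q + 1).
    by rewrite ltr_wpDl// mulr_ge0// powR_ge0.
  move=> z Az; apply: le_trans (bound u _ z (fine_ge0 D0) wu DE Az) _.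
  by rewrite lee_fin lerDl.
- move=> e e0.
  have C1 : 0 < C + 1 by rewrite ltr_wpDl.
  (* Chosen so that C r^q <= e; the added 1 avoids dividing by C, which is only known to be
     nonnegative. *)
  pose r := (e / (C + 1)) `^ q^-1.
  have r0 : 0 < r by rewrite powR_gt0// divr_gt0.
  have Cr : C * r `^ q <= e.
    rewrite -powRrM mulVf ?gt_eqF// powRr1; last by rewrite ltW// divr_gt0.
    by rewrite mulrCA ler_piMr ?(ltW e0)// ler_pdivrMr// mul1r lerDl.
  have [x /andP[ax xb]] := oint_neq0 hab.
  have Dm0 c : (0 <= Dminus a b v1 v2 p1' p2' q u c)%E by exact: D_ge0.
  have Dp0 d : (0 <= Dplus a b v1 v2 p1' p2' q u d)%E by exact: D_ge0.
  have nm : \forall c \near decr_to a, (Dminus a b v1 v2 p1' p2' q u c <= r%:E)%E.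
    exact: ((cvg_ereal0P _ Dm0).2 Dm).
  have np : \forall d \near incr_to b, (Dplus a b v1 v2 p1' p2' q u d <= r%:E)%E.
    exact: ((cvg_ereal0P _ Dp0).2 Dp).
  have [c [[ac _] Dc]] := filter_ex (filterI (near_decr_to ax) nm).
  have [d [[db _] Dd]] := filter_ex (filterI (near_incr_to xb) np).
  have wJ (x0 y0 : \bar R) :
      weight (oint a b) (fun t => u t * (\1_(oint x0 y0) t)%:E)%E.
    by apply: weight_indic; [exact: measurable_oint|exact: wu].
  exists c, d; split; [exact: ac|exact: db| |] => z Az.
    by apply: le_trans (bound _ _ _ (ltW r0) (wJ _ _) Dc Az) _; rewrite lee_fin.
  by apply: le_trans (bound _ _ _ (ltW r0) (wJ _ _) Dd Az) _; rewrite lee_fin.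
Qed.
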